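(* $\mathsf{SRT}^2_2 \not\le_{\rm sc} \mathsf{SPT}^2_2$.
   Context: A 2-coloring of pairs is $f:[\omega]^2\to 2$, with $f(x,y)$ meaning $f(\{x,y\})$ for $x<y$; it is stable if $\lim_u f(x,u)$ exists for all $x$. $A\oplus B=\{2x:x\in A\}\cup\{2y+1:y\in B\}$. An infinite set $H$ is homogeneous for $f$ if $f$ is constant on $[H]^2$. A set $H=H_L\oplus H_R$ with $H_L,H_R$ infinite is p-homogeneous for $f$ if $f(\{x,y\})$ is constant over $x\in H_L$, $y\in H_R$, $x\neq y$. $\mathsf{SRT}^2_2$ (resp. $\mathsf{SPT}^2_2$) is the problem whose instances are stable 2-colorings of pairs $f$ and whose solutions are sets homogeneous (resp. p-homogeneous) for $f$. $\mathsf P\le_{\rm sc}\mathsf Q$ if every instance $X$ of $\mathsf P$ computes an instance $\widehat X$ of $\mathsf Q$ such that every solution $\widehat Y$ of $\widehat X$ computes some solution of $X$. *)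

(* Defs.v *)
From Stdlib Require Import Arith List Cantor.
Import ListNotations.

Inductive prf : Type :=
| PZero : prf
| PSucc : prf
| PProj : nat -> prf
| POracle : prf
| PComp : prf -> list prf -> prf
| PRec : prf -> prf -> prf
| PMin : prf -> prf.

Inductive eval (a : nat -> nat) : prf -> list nat -> nat -> Prop :=
| ev_zero : forall args, eval a PZero args 0
| ev_succ : forall args, eval a PSucc args (S (hd 0 args))
| ev_proj : forall i args, eval a (PProj i) args (nth i args 0)
| ev_oracle : forall args, eval a POracle args (a (hd 0 args))
| ev_comp : forall g hs args ys r,
    evals a hs args ys -> eval a g ys r -> eval a (PComp g hs) args r
| ev_rec0 : forall g h rest r,
    eval a g rest r -> eval a (PRec g h) (0 :: rest) r
| ev_recS : forall g h n rest y r,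
    eval a (PRec g h) (n :: rest) y ->
    eval a h (n :: y :: rest) r ->
    eval a (PRec g h) (S n :: rest) r
| ev_min : forall g args n,
    eval a g (n :: args) 0 ->
    (forall m, m < n -> exists k, eval a g (m :: args) (S k)) ->
    eval a (PMin g) args n
with evals (a : nat -> nat) : list prf -> list nat -> list nat -> Prop :=
| evs_nil : forall args, evals a [] args []
| evs_cons : forall h hs args y ys,
    eval a h args y -> evals a hs args ys -> evals a (h :: hs) args (y :: ys).

Definition Tred (g a : nat -> nat) : Prop :=
  exists e : prf, forall n, eval a e [n] (g n).

Definition set_code (A : nat -> bool) : nat -> nat :=
  fun n => if A n then 1 else 0.

(** A 2-coloring of pairs: [f x y] for [x < y] is the colour of {x,y};
    values with [x >= y] are irrelevant and ignored by the code. *)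
Definition coloring := nat -> nat -> bool.

Definition col_code (f : coloring) : nat -> nat :=
  fun n => let (x, y) := Cantor.of_nat n in
           if x <? y then (if f x y then 1 else 0) else 0.

Definition fpair (f : coloring) (x y : nat) : bool :=
  if x <? y then f x y else f y x.

Definition stable (f : coloring) : Prop :=
  forall x, exists (c : bool) (N : nat), forall u, N <= u -> x < u -> f x u = c.

Definition infinite (A : nat -> bool) : Prop :=
  forall n, exists m, n <= m /\ A m = true.

Definition homogeneous (f : coloring) (H : nat -> bool) : Prop :=
  infinite H /\
  exists c : bool, forall x y, H x = true -> H y = true -> x < y -> f x y = c.

Definition join (A B : nat -> bool) : nat -> bool :=
  fun n => if Nat.even n then A (Nat.div2 n) else B (Nat.div2 n).

Definition p_homogeneous (f : coloring) (H : nat -> bool) : Prop :=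
  exists HL HR : nat -> bool,
    H = join HL HR /\ infinite HL /\ infinite HR /\
    exists c : bool, forall x y, HL x = true -> HR y = true -> x <> y ->
      fpair f x y = c.

Record problem := {
  instance : coloring -> Prop;
  solution : coloring -> (nat -> bool) -> Prop }.

Definition SRT22 : problem := {| instance := stable; solution := homogeneous |}.
Definition SPT22 : problem := {| instance := stable; solution := p_homogeneous |}.

Definition sc_le (P Q : problem) : Prop :=
  forall X, instance P X ->
    exists Xh, instance Q Xh /\ Tred (col_code Xh) (col_code X) /\
      forall Yh, solution Q Xh Yh ->
        exists Y, solution P X Y /\ Tred (set_code Y) (set_code Yh).

(* Main.v *)
Require Import Defs.
From Stdlib Require Import Arith List Cantor Lia Classical ClassicalEpsilon.
Import ListNotations.

(** The coloring [X] is generic for conditions that fix finitely many colors and finitely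
    many limits. Given an [X]-computable stable coloring [Xh], a p-homogeneous set of
    each color is built by finite extension, and for each pair of functionals one of
    the two sides must be prevented from computing a homogeneous set for [X].

    All elements are taken from a set [I], fixed before [X], that decides which outputs
    remain possible after a given finite stage. If neither side can be defeated, then an
    element that makes possible, for the side of color [true], an output with the wrong
    limit in [X] is forced to have limit color [false] in [Xh]. Almost every element of
    [I] makes some large output possible, and its limit can be chosen freely, so elements
    can be forced to the color [false] at will. Now put [a] and [a'] on the same
    side of the solution of color [false], with elements of the other side in between:
    the color of [{a,a'}] in [Xh] is irrelevant, so the outputs [x] and [z] that these two
    elements make possible can be given a color [X x z] different from their limits.
    To color [{x,z}] without losing control of the intermediate elements, the limit of
    [x] is first set to one color, then to the other, then back. *)

(** * Countability, genericity, fusion *)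

Definition countable (T : Type) : Prop :=
  exists f : T -> nat, forall x y, f x = f y -> x = y.

Lemma countable_inj (S T : Type) (g : S -> T) :
  (forall x y, g x = g y -> x = y) -> countable T -> countable S.
Proof.
  intros Hg [f Hf]. exists (fun x => f (g x)). auto.
Qed.

Lemma countable_nat : countable nat.
Proof. exists (fun n => n); auto. Qed.

Lemma countable_bool : countable bool.
Proof. exists Nat.b2n. intros [] []; simpl; congruence. Qed.

Lemma to_nat_inj a b c d :
  Cantor.to_nat (a, b) = Cantor.to_nat (c, d) -> a = c /\ b = d.
Proof.
  intro H. apply (f_equal Cantor.of_nat) in H. rewrite !Cantor.cancel_of_to in H.
  now injection H.
Qed.

Lemma countable_prod (S T : Type) :
  countable S -> countable T -> countable (S * T).
Proof.
  intros [f Hf] [g Hg]. exists (fun p => Cantor.to_nat (f (fst p), g (snd p))).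
  intros [x y] [x' y'] H. apply to_nat_inj in H as [H1 H2].
  f_equal; auto.
Qed.

Lemma countable_list (T : Type) : countable T -> countable (list T).
Proof.
  intros [f Hf].
  exists (fix code l := match l with
                 | [] => 0
                 | x :: l' => S (Cantor.to_nat (f x, code l'))
                 end).
  induction x as [|x l IH]; intros [|y l'] H; try discriminate; auto.
  apply eq_add_S, to_nat_inj in H as [H1 H2].
  f_equal; auto.
Qed.

Fixpoint prf_code (p : prf) : nat :=
  let pair k n := Cantor.to_nat (k, n) in
  match p with
  | PZero => pair 0 0
  | PSucc => pair 1 0
  | PProj i => pair 2 i
  | POracle => pair 3 0
  | PComp g hs =>
      pair 4 (pair (prf_code g)
        ((fix codes l := match l with
                    | [] => 0
                    | h :: l' => S (pair (prf_code h) (codes l'))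
                    end) hs))
  | PRec g h => pair 5 (pair (prf_code g) (prf_code h))
  | PMin g => pair 6 (prf_code g)
  end.

Lemma prf_code_inj : forall p q, prf_code p = prf_code q -> p = q.
Proof.
  (* Recursion is started by hand because [PComp] carries a list of terms: [IH] must be applied to
     the members of that list inside an inner induction on the list. *)
  fix IH 1.
  intros p q; destruct p, q; intro H; cbn -[Cantor.to_nat] in H;
    apply to_nat_inj in H as [Hk H]; try discriminate Hk; try (subst; reflexivity).
  - apply to_nat_inj in H as [H1 H2]. f_equal.
    + apply IH; exact H1.
    + revert l0 H2. induction l as [|h l IHl]; intros [|h' l'] H; try discriminate; auto.
      apply eq_add_S, to_nat_inj in H as [H2 H3]. f_equal.
      * apply IH; exact H2.
      * apply IHl; exact H3.
  - apply to_nat_inj in H as [H1 H2]. f_equal; apply IH; assumption.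
  - f_equal; apply IH; assumption.
Qed.

Lemma countable_prf : countable prf.
Proof. exists prf_code. exact prf_code_inj. Qed.

Lemma dependent_choice (T : Type) (R : nat -> T -> T -> Prop) (t0 : T) :
  (forall k t, exists t', R k t t') ->
  exists s : nat -> T, s 0 = t0 /\ forall k, R k (s k) (s (S k)).
Proof.
  intro H.
  exists (nat_rect _ t0 (fun k t => proj1_sig (constructive_indefinite_description _ (H k t)))).
  split; [reflexivity|]. intro k. simpl.
  exact (proj2_sig (constructive_indefinite_description _ (H k _))).
Qed.

(** No density is assumed. Step [k] treats the requirement of code [k], unique by injectivity: it is
    met if some extension of the current term meets it, and otherwise the current term already
    witnesses the second alternative. *)
Lemma generic_sequence (T K : Type) (le : T -> T -> Prop) (D : K -> T -> Prop) (t0 : T) :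
  (forall t, le t t) -> (forall t u v, le t u -> le u v -> le t v) ->
  countable K ->
  exists s : nat -> T, s 0 = t0 /\ (forall i j, i <= j -> le (s j) (s i)) /\
    forall q, exists k, D q (s k) \/ ~ exists t, le t (s k) /\ D q t.
Proof.
  intros Hr Ht [f Hf].
  destruct (dependent_choice T
    (fun k t t' => le t' t /\
       forall q, f q = k -> D q t' \/ ~ exists u, le u t /\ D q u) t0) as [s [Hs0 Hs]].
  { intros k t. destruct (classic (exists q, f q = k)) as [[q Hq]|Hn].
    - destruct (classic (exists u, le u t /\ D q u)) as [[u [Hu HD]]|Hno].
      + exists u. split; auto. intros q' Hq'. left.
        replace q' with q; auto. apply Hf; congruence.
      + exists t. split; auto. intros q' Hq'. right.
        replace q' with q; auto. apply Hf; congruence.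
    - exists t. split; auto. intros q Hq. exfalso; eauto. }
  exists s. repeat split; auto.
  - intros i j Hij. induction Hij; auto. apply Ht with (s m); auto. apply Hs.
  - intro q. destruct (Hs (f q)) as [_ H]. destruct (H q eq_refl) as [H'|H']; eauto.
Qed.

(** * Infinite sets of numbers and finite two-sided stages *)

Definition unbounded (J : nat -> Prop) : Prop := forall n, exists m, n <= m /\ J m.
Definition subset (J I : nat -> Prop) : Prop := forall a, J a -> I a.
Definition tail (I : nat -> Prop) (N : nat) : nat -> Prop := fun a => I a /\ N <= a.

Lemma tail_unbounded I N : unbounded I -> unbounded (tail I N).
Proof.
  intros H n. destruct (H (max n N)) as [m [Hm HI]]. exists m. unfold tail.
  repeat split; auto; lia.
Qed.

(** A finite stage of a pair [H_L], [H_R]: elements paired with their side, in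
    decreasing order. *)
Definition tagged := list (nat * bool).

Definition bound (F : tagged) : nat :=
  match F with [] => 0 | (a, _) :: _ => S a end.

Fixpoint srt (F : tagged) : Prop :=
  match F with [] => True | (a, _) :: F' => bound F' <= a /\ srt F' end.

Definition sub (J : nat -> Prop) (F : tagged) : Prop := forall b t, In (b, t) F -> J b.

Definition above (E F : tagged) : Prop := forall b t, In (b, t) E -> bound F <= b.

Lemma sub_mono J I F : subset J I -> sub J F -> sub I F.
Proof. intros H HF b t Hb. apply H. eauto. Qed.

Lemma sub_app J E F : sub J (E ++ F) <-> sub J E /\ sub J F.
Proof.
  unfold sub. split.
  - intro H. split; intros b t Hb; apply (H b t), in_or_app; auto.
  - intros [H1 H2] b t Hb. apply in_app_or in Hb as [|]; eauto.
Qed.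

Lemma sub_cons J a t F : sub J ((a, t) :: F) <-> J a /\ sub J F.
Proof.
  unfold sub. split.
  - intro H. split; [apply (H a t); left; auto|]. intros; apply (H b t0); right; auto.
  - intros [H1 H2] b t' [Hb|Hb]; [injection Hb as <- <-; auto|eauto].
Qed.

Lemma srt_bound F b t : srt F -> In (b, t) F -> b < bound F.
Proof.
  induction F as [|[a t'] F IH]; simpl; [tauto|].
  intros [H1 H2] [H|H]; [injection H as <- <-; lia|]. specialize (IH H2 H). lia.
Qed.

Lemma srt_app E F : srt (E ++ F) <-> srt E /\ srt F /\ above E F.
Proof.
  induction E as [|[a t] E IH]; simpl.
  - unfold above; simpl; tauto.
  - rewrite IH. split.
    + intros [H1 [H2 [H3 H4]]]. repeat split; auto.
      * destruct E as [|[a' t'] E]; simpl in *; lia.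
      * intros b t' [Hb|Hb]; [injection Hb as <- <-|eapply H4; eauto].
        destruct E as [|[a' t''] E]; simpl in *; auto.
        specialize (H4 a' t'' (or_introl eq_refl)). lia.
    + intros [[H1 H2] [H3 H4]]. repeat split; auto.
      * destruct E as [|[a' t'] E]; simpl in *; auto.
        apply (H4 a t). left; auto.
      * intros b t' Hb. apply (H4 b t'). right; auto.
Qed.

Lemma bound_app E F : srt (E ++ F) -> bound F <= bound (E ++ F).
Proof.
  destruct E as [|[a t] E]; simpl; auto.
  intros [H1 H2]. apply srt_app in H2 as [_ [_ H2]].
  destruct E as [|[a' t'] E]; simpl in *; [lia|].
  specialize (H2 a' t' (or_introl eq_refl)). lia.
Qed.

Lemma finite_tagged m : exists L : list tagged, forall E, srt E -> bound E <= m -> In E L.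
Proof.
  induction m as [|m [L HL]].
  - exists [[]]. intros [|[a t] E] _ H; simpl in *; auto; lia.
  - exists (L ++ map (cons (m, true)) L ++ map (cons (m, false)) L).
    intros E HE Hb. destruct E as [|[a t] E].
    + apply in_or_app; left; apply HL; simpl; auto; lia.
    + simpl in HE, Hb. destruct HE as [H1 H2].
      destruct (Nat.eq_dec a m) as [->|Hne].
      * apply in_or_app; right. apply in_or_app.
        destruct t; [left|right]; apply in_map, HL; auto.
      * apply in_or_app; left; apply HL; simpl; auto; lia.
Qed.

(** Both [Unav] and [Avoid] pass to subsets, so a decision made by thinning [I] is never undone by
    later thinnings. *)
Definition Unav (I : nat -> Prop) (H : tagged -> Prop) : Prop :=
  forall J, subset J I -> unbounded J -> exists E, srt E /\ sub J E /\ H E.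

Definition Avoid (I : nat -> Prop) (H : tagged -> Prop) : Prop :=
  exists N, forall E, srt E -> sub (tail I N) E -> ~ H E.

Lemma Unav_subset I J H : subset J I -> Unav I H -> Unav J H.
Proof. intros HJ HU K HK. apply HU. intros a Ha. auto. Qed.

Lemma Avoid_subset I J H : subset J I -> Avoid I H -> Avoid J H.
Proof.
  intros HJ [N HN]. exists N. intros E HE Hs. apply HN; auto.
  revert Hs. apply sub_mono. intros a [Ha Hb]. split; auto.
Qed.

(** Take a generic decreasing sequence of infinite sets, each trying to omit the families [H q]. If
    no infinite subset of some term omits [H q], then [H q] is unavoidable below it. A diagonal set
    [J], contained in every term up to finitely many elements, inherits all the decisions. *)
Lemma fusion (K : Type) (H : K -> tagged -> Prop) (I : nat -> Prop) :
  countable K -> unbounded I ->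
  exists J, subset J I /\ unbounded J /\ forall q, Unav J (H q) \/ Avoid J (H q).
Proof.
  intros HK HI.
  destruct (generic_sequence {J | subset J I /\ unbounded J} K
    (fun J' J => subset (proj1_sig J') (proj1_sig J))
    (fun q J => forall E, srt E -> sub (proj1_sig J) E -> ~ H q E)
    (exist _ I (conj (fun a Ha => Ha) HI))) as [s [_ [Hs HD]]]; auto.
  { intros t a Ha; auto. }
  { intros t u v H1 H2 a Ha; auto. }
  pose (S_ k := proj1_sig (s k)).
  assert (HSI : forall k, subset (S_ k) I /\ unbounded (S_ k)).
  { intro k. exact (proj2_sig (s k)). }
  assert (Hdec : forall i j, i <= j -> subset (S_ j) (S_ i)) by (intros; apply Hs; auto).
  destruct (dependent_choice nat (fun k a a' => a < a' /\ S_ k a') 0) as [g [_ Hg]].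
  { intros k a. destruct (proj2 (HSI k) (S a)) as [m [Hm HSm]]. exists m. auto. }
  assert (Hgm : forall i j, i <= j -> g i <= g j).
  { intros i j Hij. induction Hij; auto. destruct (Hg m). lia. }
  assert (Hgid : forall k, k <= g k).
  { induction k; [lia|]. destruct (Hg k). lia. }
  (* The successor matters: [g (S k)] lies in [S_ k], while [g 0] is an arbitrary starting value. *)
  exists (fun a => exists k, a = g (S k)).
  assert (Htail : forall k, subset (tail (fun a => exists k, a = g (S k)) (g (S k))) (S_ k)).
  { intros k a [[j ->] Hle].
    assert (k <= j).
    { destruct (le_lt_dec k j); auto. assert (g (S j) <= g k) by (apply Hgm; lia).
      destruct (Hg k). lia. }
    apply (Hdec k j); auto. apply Hg. }
  split; [|split].
  - intros a [k ->]. apply (HSI k). apply Hg.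
  - intro n. exists (g (S n)). split; [specialize (Hgid (S n)); lia|]. eauto.
  - intro q. destruct (HD q) as [k [HA|HU]].
    + right. exists (g (S k)). intros E HE Hsub. apply HA; auto.
      revert Hsub. apply sub_mono, Htail.
    + left. intros J HJ HJu. apply NNPP. intro Hn. apply HU.
      assert (HJS : subset (tail J (g (S k))) (S_ k)).
      { intros a [Ha Hle]. apply (Htail k). split; auto. }
      assert (P : subset (tail J (g (S k))) I /\ unbounded (tail J (g (S k)))).
      { split; [intros a Ha; apply (HSI k), HJS, Ha|]. now apply tail_unbounded. }
      exists (exist (fun J => subset J I /\ unbounded J) (tail J (g (S k))) P). split; [exact HJS|].
      simpl. intros E HE Hsub HH. apply Hn. exists E. repeat split; auto.
      revert Hsub. apply sub_mono. intros a [Ha _]; auto.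
Qed.

(** * Properties of almost every element, and pools of candidates *)

Definition ev (I P : nat -> Prop) : Prop := exists N, forall a, I a -> N <= a -> P a.

Lemma ev_subset I J P : subset J I -> ev I P -> ev J P.
Proof. intros H [N HN]. exists N. auto. Qed.

Lemma ev_and I P Q : ev I P -> ev I Q -> ev I (fun a => P a /\ Q a).
Proof.
  intros [N HN] [M HM]. exists (max N M). intros a Ha Hle.
  split; [apply HN|apply HM]; auto; lia.
Qed.

Lemma ev_imp I (P Q : nat -> Prop) : (forall a, I a -> P a -> Q a) -> ev I P -> ev I Q.
Proof. intros H [N HN]. exists N. auto. Qed.

Lemma ev_ge I N : ev I (fun a => N <= a).
Proof. exists N. auto. Qed.

Lemma ev_below I (P : nat -> nat -> Prop) m :
  (forall x, x < m -> ev I (P x)) -> ev I (fun a => forall x, x < m -> P x a).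
Proof.
  induction m as [|m IH]; intro H.
  - exists 0. intros; lia.
  - destruct IH as [N HN]; [intros; apply H; lia|].
    destruct (H m) as [M HM]; [lia|].
    exists (max N M). intros a Ha Hle x Hx.
    destruct (Nat.eq_dec x m) as [->|]; [apply HM|apply HN]; auto; lia.
Qed.

Lemma ev_list I (T : Type) (P : T -> nat -> Prop) L :
  (forall x, In x L -> ev I (P x)) -> ev I (fun a => forall x, In x L -> P x a).
Proof.
  induction L as [|y L IH]; intro H.
  - exists 0. intros a _ _ x [].
  - destruct IH as [N HN]; [intros; apply H; right; auto|].
    destruct (H y) as [M HM]; [left; auto|].
    exists (max N M). intros a Ha Hle x [<-|Hx]; [apply HM|apply HN]; auto; lia.
Qed.

Lemma ev_exists I P : unbounded I -> ev I P -> exists a, I a /\ P a.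
Proof. intros HI [N HN]. destruct (HI N) as [a [Ha Hb]]. eauto. Qed.

(** This is [fusion] for one-element stages, with the tag ignored. If the property is unavoidable,
    its exceptions cannot form an infinite subset of [J], so there are finitely many. *)
Lemma cohesive (K : Type) (P : K -> nat -> Prop) (I : nat -> Prop) :
  countable K -> unbounded I ->
  exists J, subset J I /\ unbounded J /\
    forall q, ev J (P q) \/ ev J (fun a => ~ P q a).
Proof.
  intros HK HI.
  destruct (fusion K (fun q E => exists a t, E = [(a, t)] /\ P q a) I HK HI)
    as [J [H1 [H2 H3]]].
  exists J. split; [|split]; auto. intro q. destruct (H3 q) as [HU|[N HN]].
  - left. apply NNPP. intro Hn.
    destruct (HU (fun a => J a /\ ~ P q a)) as [E [_ [HE [a [t [-> Ha]]]]]].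
    + intros a [Ha _]; auto.
    + intro n. apply NNPP. intro Hb. apply Hn. exists n. intros a Ha Hle.
      apply NNPP. intro HP. apply Hb. exists a. auto.
    + apply (HE a t); simpl; auto.
  - right. exists N. intros a Ha Hle HP. apply (HN [(a, true)]).
    + simpl. split; auto; lia.
    + intros b t [Hb|[]]. injection Hb as <- <-. split; auto.
    + eauto.
Qed.

(** Iterating the step produces an infinite pool of candidates, and unavoidability places some [E]
    inside it. Since [E] is finite, it already lies in a finite pool [A] for which the invariant
    holds. Which candidates are used, and on which side, is thus settled only at the end. *)
Lemma harvest (T : Type) (I : nat -> Prop) (Inv : T -> list nat -> Prop) (t0 : T)
    (H : tagged -> Prop) :
  Inv t0 [] ->
  (forall t A, Inv t A -> exists N, forall n, exists a t', n <= a /\ I a /\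
     (N <= a -> Inv t' (a :: A))) ->
  Unav I H ->
  exists t A E, Inv t A /\ srt E /\ sub (fun b => In b A) E /\ sub I E /\ H E.
Proof.
  intros H0 Hstep HU.
  destruct (dependent_choice {p : T * list nat | Inv (fst p) (snd p)}
    (fun k p p' => exists a, k <= a /\ I a /\
       snd (proj1_sig p') = a :: snd (proj1_sig p)) (exist _ (t0, []) H0)) as [s [Hs0 Hs]].
  { intros k [[t A] HA]. simpl in *. destruct (Hstep t A HA) as [N HN].
    destruct (HN (max k N)) as [a [t' [Ha [HI HInv]]]].
    assert (HInv' : Inv t' (a :: A)) by (apply HInv; lia).
    exists (exist _ (t', a :: A) HInv'). simpl. exists a. repeat split; auto. lia. }
  pose (A_ k := snd (proj1_sig (s k))).
  assert (Hmon : forall i j, i <= j -> forall b, In b (A_ i) -> In b (A_ j)).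
  { intros i j Hij. induction Hij; auto. intros b Hb.
    destruct (Hs m) as [a [_ [_ Ha]]]. unfold A_. rewrite Ha. right. apply IHHij; auto. }
  assert (HAI : forall k b, In b (A_ k) -> I b).
  { induction k.
    - unfold A_. rewrite Hs0. simpl. tauto.
    - destruct (Hs k) as [a [_ [Ha Heq]]]. unfold A_ in *. rewrite Heq.
      intros b [<-|Hb]; auto. }
  destruct (HU (fun b => exists k, In b (A_ k))) as [E [HE1 [HE2 HE3]]].
  - intros b [k Hk]. eauto.
  - intro n. destruct (Hs n) as [a [Hle [_ Heq]]]. exists a. split; auto.
    exists (S n). unfold A_. rewrite Heq. left; auto.
  - assert (Hk : exists k, sub (fun b => In b (A_ k)) E).
    { clear HE1 HE3. induction E as [|[a t] E IH].
      - exists 0. intros b t [].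
      - apply sub_cons in HE2 as [[k Hk] HE2]. destruct (IH HE2) as [k' Hk'].
        exists (max k k'). apply sub_cons. split.
        + apply (Hmon k); auto; lia.
        + intros b t' Hb. apply (Hmon k'); [lia|]. eapply Hk'; eauto. }
    destruct Hk as [k Hk].
    exists (fst (proj1_sig (s k))), (A_ k), E. repeat split; auto.
    + exact (proj2_sig (s k)).
    + intros b t Hb. apply (HAI k). eapply Hk; eauto.
Qed.

(** * Oracle computations: determinism and use *)

Section EvalInd.

Variable a : nat -> nat.
Variable P : prf -> list nat -> nat -> Prop.
Variable Q : list prf -> list nat -> list nat -> Prop.

Hypothesis Hzero : forall args, P PZero args 0.
Hypothesis Hsucc : forall args, P PSucc args (S (hd 0 args)).
Hypothesis Hproj : forall i args, P (PProj i) args (nth i args 0).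
Hypothesis Horacle : forall args, P POracle args (a (hd 0 args)).
Hypothesis Hcomp : forall g hs args ys r,
  evals a hs args ys -> Q hs args ys -> P g ys r -> P (PComp g hs) args r.
Hypothesis Hrec0 : forall g h rest r, P g rest r -> P (PRec g h) (0 :: rest) r.
Hypothesis HrecS : forall g h n rest y r,
  P (PRec g h) (n :: rest) y -> P h (n :: y :: rest) r -> P (PRec g h) (S n :: rest) r.
Hypothesis Hmin : forall g args n,
  P g (n :: args) 0 ->
  (forall m, m < n -> exists k, P g (m :: args) (S k)) -> P (PMin g) args n.
Hypothesis Hnil : forall args, Q [] args [].
Hypothesis Hcons : forall h hs args y ys,
  P h args y -> Q hs args ys -> Q (h :: hs) args (y :: ys).

(** The recursion goes explicitly through the existential premise of [ev_min], so the values tested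
    below the minimum also carry induction hypotheses. *)
Fixpoint eval_strong_ind p args r (H : eval a p args r) {struct H} : P p args r :=
  match H in eval _ p args r return P p args r with
  | ev_zero _ args => Hzero args
  | ev_succ _ args => Hsucc args
  | ev_proj _ i args => Hproj i args
  | ev_oracle _ args => Horacle args
  | ev_comp _ g hs args ys r H1 H2 =>
      Hcomp g hs args ys r H1 (evals_strong_ind hs args ys H1) (eval_strong_ind g ys r H2)
  | ev_rec0 _ g h rest r H1 => Hrec0 g h rest r (eval_strong_ind _ _ _ H1)
  | ev_recS _ g h n rest y r H1 H2 =>
      HrecS g h n rest y r (eval_strong_ind _ _ _ H1) (eval_strong_ind _ _ _ H2)
  | ev_min _ g args n H1 H2 =>
      Hmin g args n (eval_strong_ind _ _ _ H1)
        (fun m Hm => match H2 m Hm with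
                     | ex_intro _ k Hk => ex_intro _ k (eval_strong_ind _ _ _ Hk)
                     end)
  end
with evals_strong_ind hs args ys (H : evals a hs args ys) {struct H} : Q hs args ys :=
  match H in evals _ hs args ys return Q hs args ys with
  | evs_nil _ args => Hnil args
  | evs_cons _ h hs args y ys H1 H2 =>
      Hcons h hs args y ys (eval_strong_ind _ _ _ H1) (evals_strong_ind _ _ _ H2)
  end.

End EvalInd.

Lemma eval_det a p args r r' : eval a p args r -> eval a p args r' -> r = r'.
Proof.
  intro H. revert r'. revert p args r H.
  apply (eval_strong_ind a (fun p args r => forall r', eval a p args r' -> r = r')
    (fun hs args ys => forall ys', evals a hs args ys' -> ys = ys')).
  - intros args r' H. now inversion H.
  - intros args r' H. now inversion H.
  - intros i args r' H. now inversion H.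
  - intros args r' H. now inversion H.
  - intros g hs args ys r _ IH1 IH2 r' H. inversion H; subst.
    apply IH2. erewrite IH1; eauto.
  - intros g h rest r IH r' H. inversion H; subst. auto.
  - intros g h n rest y r IH1 IH2 r' H. inversion H; subst.
    apply IH2. erewrite IH1; eauto.
  - intros g args n IH1 IH2 r' H. inversion H; subst.
    match goal with H1 : eval _ g (r' :: _) 0, H2 : forall m, m < r' -> _ |- _ =>
      rename H1 into HA; rename H2 into HB end.
    (* If two minima differed, the smaller argument would have both the value 0 and a successor
       value. *)
    destruct (lt_eq_lt_dec n r') as [[Hlt|Heq]|Hlt]; auto.
    + destruct (HB n Hlt) as [k Hk]. apply IH1 in Hk. discriminate.
    + destruct (IH2 r' Hlt) as [k Hk]. apply Hk in HA. discriminate.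
  - intros args ys' H. now inversion H.
  - intros h hs args y ys IH1 IH2 ys' H. inversion H; subst.
    f_equal; auto.
Qed.

Lemma bounded_choice (P : nat -> nat -> Prop) n :
  (forall m N N', P m N -> N <= N' -> P m N') ->
  (forall m, m < n -> exists N, P m N) -> exists N, forall m, m < n -> P m N.
Proof.
  intros Hmono. induction n as [|n IH]; intro H.
  - exists 0. intros; lia.
  - destruct IH as [N HN]; [intros; apply H; lia|].
    destruct (H n) as [M HM]; [lia|].
    exists (max N M). intros m Hm. destruct (Nat.eq_dec m n) as [->|].
    + apply Hmono with M; auto; lia.
    + apply Hmono with N; auto; [apply HN|]; lia.
Qed.

Lemma eval_use a p args r :
  eval a p args r ->
  exists n, forall b, (forall i, i < n -> b i = a i) -> eval b p args r.
Proof.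
  revert p args r.
  apply (eval_strong_ind a
    (fun p args r => exists n, forall b, (forall i, i < n -> b i = a i) -> eval b p args r)
    (fun hs args ys =>
       exists n, forall b, (forall i, i < n -> b i = a i) -> evals b hs args ys)).
  - exists 0. constructor.
  - exists 0. constructor.
  - exists 0. constructor.
  - intro args. exists (S (hd 0 args)). intros b Hb.
    rewrite <- Hb by lia. constructor.
  - intros g hs args ys r _ [n Hn] [m Hm]. exists (max n m). intros b Hb.
    econstructor; [apply Hn|apply Hm]; intros; apply Hb; lia.
  - intros g h rest r [n Hn]. exists n. intros b Hb. constructor. auto.
  - intros g h n rest y r [k Hk] [m Hm]. exists (max k m). intros b Hb.
    econstructor; [apply Hk|apply Hm]; intros; apply Hb; lia.
  - intros g args n [k Hk] H.
    destruct (bounded_choice (fun m N => exists j, forall b, (forall i, i < N -> b i = a i) ->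
      eval b g (m :: args) (S j)) n) as [M HM].
    + intros m N N' [j Hj] Hle. exists j. intros b Hb. apply Hj. intros; apply Hb; lia.
    + intros m Hm. destruct (H m Hm) as [j [N HN]]. eauto.
    + exists (max k M). intros b Hb. constructor.
      * apply Hk. intros; apply Hb; lia.
      * intros m Hm. destruct (HM m Hm) as [j Hj]. exists j. apply Hj.
        intros; apply Hb; lia.
  - exists 0. constructor.
  - intros h hs args y ys [n Hn] [m Hm]. exists (max n m). intros b Hb.
    constructor; [apply Hn|apply Hm]; intros; apply Hb; lia.
Qed.

Definition agree (n : nat) (X Y : coloring) : Prop :=
  forall x y, x < y -> y < n -> X x y = Y x y.

Definition Phi (e : prf) (X : coloring) (a u k : nat) : Prop :=
  eval (col_code X) e [Cantor.to_nat (a, u)] k.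

Lemma Phi_det e X a u k k' : Phi e X a u k -> Phi e X a u k' -> k = k'.
Proof. apply eval_det. Qed.

Lemma Phi_use e X a u k : Phi e X a u k -> exists n, forall Y, agree n Y X -> Phi e Y a u k.
Proof.
  intro H. destruct (eval_use _ _ _ _ H) as [n Hn]. exists n. intros Y HY.
  apply Hn. intros i Hi. unfold col_code.
  destruct (Cantor.of_nat i) as [x y] eqn:E.
  destruct (x <? y) eqn:Hxy; auto. apply Nat.ltb_lt in Hxy.
  rewrite HY; auto. apply (f_equal Cantor.to_nat) in E. rewrite Cantor.cancel_to_of in E.
  assert (Hle := Cantor.to_nat_non_decreasing x y). lia.
Qed.

(** * The finite stages of a solution and their outputs *)

Definition follows (G : bool -> nat -> bool) (F : tagged) : Prop :=
  forall t k, k < bound F -> (G t k = true <-> In (k, t) F).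

(** Only the answer 1 is recorded: to defeat [d] it is enough to control the elements that it puts
    into its set. Since every oracle that follows [F] must give this answer, it persists in
    extensions of [F]. *)
Definition Out (d : prf) (F : tagged) (x : nat) : Prop :=
  forall G, follows G F -> eval (set_code (join (G true) (G false))) d [x] 1.

Lemma follows_app G E F : srt (E ++ F) -> follows G (E ++ F) -> follows G F.
Proof.
  intros Hs HG t k Hk. assert (Hb := bound_app E F Hs).
  destruct (HG t k) as [H1 H2]; [lia|]. split; [|intro; apply H2, in_or_app; auto].
  intro H. apply H1, in_app_or in H as [H|]; auto.
  apply srt_app in Hs as [_ [_ Ha]]. specialize (Ha _ _ H). lia.
Qed.

Lemma Out_app d E F x : srt (E ++ F) -> Out d F x -> Out d (E ++ F) x.
Proof. intros Hs H G HG. apply H. now apply follows_app with E. Qed.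

Lemma Out_use d (G : bool -> nat -> bool) x :
  eval (set_code (join (G true) (G false))) d [x] 1 ->
  exists n, forall F, n <= bound F -> follows G F -> Out d F x.
Proof.
  intro H. destruct (eval_use _ _ _ _ H) as [n Hn]. exists n. intros F HF HG G' HG'.
  apply Hn. intros i Hi. unfold set_code, join.
  (* Position [i] of the join asks about the number [Nat.div2 i], which is at most [i]; hence the
     use of the computation bounds the part of both sides that matters. *)
  assert (Hd : Nat.div2 i < bound F) by (assert (Hx := Nat.div2_decr i i); lia).
  assert (HGG : forall t, G' t (Nat.div2 i) = G t (Nat.div2 i)).
  { intro t. specialize (HG t _ Hd). specialize (HG' t _ Hd).
    destruct (G t (Nat.div2 i)), (G' t (Nat.div2 i)); intuition congruence. }
  now rewrite !HGG.
Qed.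

(** * Conditions on the coloring *)

(** The colors of pairs below [len] are [col], and [lim x] is the color of [{x,y}]
    for [x < len <= y]. *)
Record cond := { len : nat; col : coloring; lim : nat -> bool }.

Definition mem (r : cond) (X : coloring) : Prop :=
  agree (len r) X (col r) /\ forall x y, x < len r -> len r <= y -> X x y = lim r x.

Definition le (r' r : cond) : Prop :=
  len r <= len r' /\ agree (len r) (col r') (col r) /\
  (forall x, x < len r -> lim r' x = lim r x) /\
  (forall x y, x < len r -> len r <= y -> y < len r' -> col r' x y = lim r x).

Lemma le_refl r : le r r.
Proof. repeat split; auto. intros x y; lia. Qed.

Lemma le_trans r s t : le r s -> le s t -> le r t.
Proof.
  intros [A1 [A2 [A3 A4]]] [B1 [B2 [B3 B4]]]. repeat split.
  - lia.
  - intros x y Hx Hy. rewrite A2 by lia. apply B2; auto.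
  - intros x Hx. rewrite A3 by lia. auto.
  - intros x y Hx Hy Hy'. destruct (le_lt_dec (len s) y).
    + rewrite A4 by lia. auto.
    + rewrite A2 by lia. apply B4; auto.
Qed.

Lemma le_agree r s : le r s -> agree (len s) (col r) (col s).
Proof. intros [_ [H _]]. exact H. Qed.

Lemma mem_le r s X : le r s -> mem r X -> mem s X.
Proof.
  intros [A1 [A2 [A3 A4]]] [B1 B2]. split.
  - intros x y Hx Hy. rewrite B1 by lia. auto.
  - intros x y Hx Hy. destruct (le_lt_dec (len r) y).
    + rewrite B2 by lia. auto.
    + rewrite B1 by lia. auto.
Qed.

Definition completion (r : cond) : coloring :=
  fun x y => if y <? len r then col r x y else lim r x.

Lemma mem_completion r : mem r (completion r).
Proof.
  unfold completion. split.
  - intros x y Hx Hy. apply Nat.ltb_lt in Hy. now rewrite Hy.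
  - intros x y Hx Hy. apply Nat.ltb_ge in Hy. now rewrite Hy.
Qed.

Definition restrict (r : cond) (X : coloring) (n : nat) (g : nat -> bool) : cond :=
  {| len := n; col := X; lim := fun x => if x <? len r then lim r x else g x |}.

Lemma restrict_le r X n g : mem r X -> len r <= n -> le (restrict r X n g) r.
Proof.
  intros [H1 H2] Hn. repeat split; simpl; auto.
  intros x Hx. apply Nat.ltb_lt in Hx. now rewrite Hx.
Qed.

Lemma le_extend r n b :
  exists r', le r' r /\ n <= len r' /\
    forall x, len r <= x -> lim r' x = b.
Proof.
  exists (restrict r (completion r) (max n (len r)) (fun _ => b)). split; [|split].
  - apply restrict_le; [apply mem_completion|lia].
  - simpl; lia.
  - intros x Hx. simpl. apply Nat.ltb_ge in Hx. now rewrite Hx.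
Qed.

(** Colors of pairs survive a change of the limits, hence so does every [Val]. *)
Definition switch (m M : nat) (b : bool) (s : cond) : cond :=
  {| len := len s; col := col s;
     lim := fun x => if andb (m <=? x) (x <? M) then b else lim s x |}.

Lemma switch_le r s M b : le s r -> le (switch (len r) M b s) r.
Proof.
  intros [A1 [A2 [A3 A4]]]. repeat split; simpl; auto.
  intros x Hx. destruct (len r <=? x) eqn:E; simpl; auto.
  apply Nat.leb_le in E. lia.
Qed.

Lemma switch_in m M b s x : m <= x -> x < M -> lim (switch m M b s) x = b.
Proof.
  intros H1 H2. simpl. apply Nat.leb_le in H1. apply Nat.ltb_lt in H2.
  now rewrite H1, H2.
Qed.

Lemma switch_out m M b s x : M <= x -> lim (switch m M b s) x = lim s x.
Proof.
  intros H. simpl. apply Nat.ltb_ge in H. rewrite H. now rewrite Bool.andb_false_r.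
Qed.

(** * Forcing facts about the computed coloring *)

(** [Val] depends only on the finitely many colors of the condition, whereas [dec] quantifies over
    its members and so depends on the limits too. [dec] constrains the values that occur, without
    asserting convergence. *)
Definition Val (e : prf) (r : cond) (a u k : nat) : Prop :=
  forall X, agree (len r) X (col r) -> Phi e X a u k.

Definition dec (e : prf) (r : cond) (a : nat) (c : bool) (N : nat) : Prop :=
  forall X, mem r X -> forall u k, N <= u -> a < u -> Phi e X a u k -> k = Nat.b2n c.

(** A local form of the totality and stability of the computed coloring: below every extension, each
    value and each limit color can still be settled. *)
Definition Alive (e : prf) (r : cond) : Prop :=
  forall s, le s r ->
    (forall a u, a < u -> exists s' k, le s' s /\ Val e s' a u k) /\
    (forall a, exists s' c N, le s' s /\ dec e s' a c N).

(** The stage [F] can belong to a p-homogeneous set of color [c]. *)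
Definition Adm (e : prf) (r : cond) (c : bool) (F : tagged) : Prop :=
  (forall a t, In (a, t) F -> exists N, dec e r a c N) /\
  (forall a b t t', In (a, t) F -> In (b, t') F -> t <> t' -> a < b ->
     Val e r a b (Nat.b2n c)).

(** The elements of [A] can be added to [F] on either side. *)
Definition Hom (e : prf) (r : cond) (c : bool) (A : list nat) (F : tagged) : Prop :=
  (forall b, In b A -> exists N, dec e r b c N) /\
  (forall b b', In b A -> In b' A \/ (exists t, In (b', t) F) -> b' < b ->
     Val e r b' b (Nat.b2n c)).

Lemma Val_col e r s a u k : agree (len r) (col s) (col r) -> len r <= len s ->
  Val e r a u k -> Val e s a u k.
Proof.
  intros H1 H2 H X HX. apply H. intros x y Hx Hy. rewrite HX by lia. auto.
Qed.

Lemma Val_le e r s a u k : le s r -> Val e r a u k -> Val e s a u k.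
Proof. intros [H1 [H2 _]]. now apply Val_col. Qed.

Lemma dec_le e r s a c N M : le s r -> N <= M -> dec e r a c N -> dec e s a c M.
Proof.
  intros H HN HD X HX u k Hu Ha HP. apply (HD X) with u; auto.
  - now apply mem_le with s.
  - lia.
Qed.

Lemma Val_dec e r s a u k c N : le s r -> dec e r a c N -> N <= u -> a < u ->
  Val e s a u k -> k = Nat.b2n c.
Proof.
  intros Hle HD HN Ha HV. apply (HD (completion s)) with u; auto.
  - apply mem_le with s; auto. apply mem_completion.
  - apply HV. apply (mem_completion s).
Qed.

Lemma Adm_le e r s c F : le s r -> Adm e r c F -> Adm e s c F.
Proof.
  intros Hle [H1 H2]. split.
  - intros a t Ha. destruct (H1 a t Ha) as [N HN]. exists N. now apply dec_le with r N.
  - intros a b t t' Ha Hb Ht Hab. apply Val_le with r; eauto.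
Qed.

Lemma Adm_nil e r c : Adm e r c [].
Proof. split; [intros a t []|intros a b t t' []]. Qed.

Lemma Alive_le e r s : le s r -> Alive e r -> Alive e s.
Proof. intros H HA u Hu. apply HA. now apply le_trans with s. Qed.

Lemma Hom_nil e r c F : Hom e r c [] F.
Proof. split; [intros b []|intros b b' []]. Qed.

Lemma Hom_Adm e r c A E F : Adm e r c F -> Hom e r c A F ->
  sub (fun b => In b A) E -> srt (E ++ F) -> Adm e r c (E ++ F).
Proof.
  intros [H1 H2] [H3 H4] HE Hs. split.
  - intros a t Ha. apply in_app_or in Ha as [Ha|Ha].
    + apply H3. now apply (HE a t).
    + eauto.
  - apply srt_app in Hs as [_ [HF Hab]].
    intros a b t t' Ha Hb Ht Hlt. apply in_app_or in Ha as [Ha|Ha];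
    apply in_app_or in Hb as [Hb|Hb].
    + apply H4; [now apply (HE b t')|left; now apply (HE a t)|auto].
    + exfalso. assert (K1 := srt_bound _ _ _ HF Hb). specialize (Hab _ _ Ha). lia.
    + apply H4; [now apply (HE b t')|right; eauto|auto].
    + eapply H2; eauto.
Qed.

Lemma all_values e r (L : list (nat * nat)) : Alive e r ->
  (forall a u, In (a, u) L -> a < u) ->
  exists s, le s r /\ forall a u, In (a, u) L -> exists k, Val e s a u k.
Proof.
  intro HA. induction L as [|[a u] L IH]; intro HL.
  - exists r. split; [apply le_refl|]. intros a u [].
  - destruct IH as [s [Hs HV]]; [intros; apply HL; right; auto|].
    destruct (proj1 (HA s Hs) a u) as [s' [k [Hs' HV']]]; [apply HL; left; auto|].
    exists s'. split; [now apply le_trans with s|].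
    intros a' u' [H|H]; [injection H as <- <-; eauto|].
    destruct (HV a' u' H) as [k' Hk']. exists k'. now apply Val_le with s.
Qed.

Lemma all_decided e r (L : list nat) : Alive e r ->
  exists s, le s r /\ forall a, In a L -> exists c N, dec e s a c N.
Proof.
  intro HA. induction L as [|a L [s [Hs HD]]].
  - exists r. split; [apply le_refl|]. intros a [].
  - destruct (proj2 (HA s Hs) a) as [s' [c [N [Hs' HD']]]].
    exists s'. split; [now apply le_trans with s|].
    intros a' [<-|H]; [eauto|].
    destruct (HD a' H) as [c' [N' H']]. exists c', N'. now apply dec_le with s N'.
Qed.

Lemma list_bound (T : Type) (P : T -> nat -> Prop) (L : list T) :
  (forall x N N', P x N -> N <= N' -> P x N') ->
  (forall x, In x L -> exists N, P x N) -> exists N, forall x, In x L -> P x N.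
Proof.
  intro Hm. induction L as [|y L IH]; intro H.
  - exists 0. intros x [].
  - destruct IH as [N HN]; [intros; apply H; right; auto|].
    destruct (H y) as [M HM]; [left; auto|].
    exists (max N M). intros x [<-|Hx].
    + apply Hm with M; auto; lia.
    + apply Hm with N; auto; lia.
Qed.

(** The old elements already have limit color [c]. Beyond a common threshold [N0], which depends
    only on [r], [A] and [F], their pairs with [b] can only take the value [c], so it suffices to
    make these finitely many values converge. *)
Lemma Hom_step e r c A F : Alive e r -> Adm e r c F -> Hom e r c A F ->
  exists N0, forall b s M, N0 <= b -> le s r -> dec e s b c M ->
    exists s', le s' s /\ Hom e s' c (b :: A) F.
Proof.
  intros HA [HF HF'] [HD HH].
  (* The conjunct [b < N] makes any new element beyond [N0] larger than all the old ones. *)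
  destruct (list_bound nat (fun b N => b < N /\ dec e r b c N) (A ++ map fst F))
    as [N0 HN0].
  { intros x N N' [H1 H2] Hle. split; [lia|]. apply dec_le with r N; auto. apply le_refl. }
  { intros x Hx. apply in_app_or in Hx as [Hx|Hx].
    - destruct (HD x Hx) as [N HN]. exists (max N (S x)). split; [lia|].
      apply dec_le with r N; auto; [apply le_refl|lia].
    - apply in_map_iff in Hx as [[a t] [<- Hx]]. destruct (HF a t Hx) as [N HN].
      exists (max N (S a)). split; simpl; [lia|].
      apply dec_le with r N; auto; [apply le_refl|lia]. }
  exists N0. intros b s M Hb Hs Hdec.
  destruct (all_values e s (map (fun a => (a, b)) (A ++ map fst F))) as [s' [Hs' HV]].
  { now apply Alive_le with r. }
  { intros a u H. apply in_map_iff in H as [x [H Hx]]. injection H as <- <-.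
    destruct (HN0 x Hx). lia. }
  assert (Hs'r : le s' r) by now apply le_trans with s.
  exists s'. split; auto. split.
  - intros b' [<-|Hb']; [exists M; now apply dec_le with s M|].
    destruct (HD b' Hb') as [N HN]. exists N. now apply dec_le with r N.
  - assert (HbA : forall b', In b' A \/ (exists t, In (b', t) F) -> In b' (A ++ map fst F)).
    { intros b' [H|[t H]]; apply in_or_app; [left|right]; auto.
      apply in_map_iff. exists (b', t); auto. }
    intros b1 b2 [<-|Hb1] Hb2 Hlt.
    + destruct Hb2 as [[<-|Hb2]|Hb2]; [lia| |];
      (assert (Hin : In b2 (A ++ map fst F)) by (apply HbA; auto);
       destruct (HV b2 b) as [k Hk]; [apply in_map_iff; eauto|];
       destruct (HN0 b2 Hin) as [H1 H2];
       rewrite <- (Val_dec e r s' b2 b k c N0); auto).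
    + destruct Hb2 as [[<-|Hb2]|Hb2].
      * destruct (HN0 b1); [apply HbA; auto|]. lia.
      * apply Val_le with r; auto.
      * apply Val_le with r; auto.
Qed.

(** * The reservoir *)

Definition Adding (F : tagged) (G : tagged -> Prop) : tagged -> Prop :=
  fun E => above E F /\ G (E ++ F).

Definition richQ (I : nat -> Prop) (Q : prf -> tagged -> nat -> bool -> Prop)
    (d : prf) (F : tagged) (t : bool) : Prop :=
  forall n, ev I (fun a => exists x, n < x /\ Q d ((a, t) :: F) x t).

(** [Pos d F x]: [x] can be output in every infinite part of the reservoir;
    [Rich d F t]: single elements on side [t] make arbitrarily large outputs possible;
    [Q d F x t]: [x] can be output in every infinite part of the reservoir, reaching a
    stage that is again rich on side [t]. *)
Record reservoir (I : nat -> Prop) (Pos : prf -> tagged -> nat -> Prop)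
    (Rich : prf -> tagged -> bool -> Prop)
    (Q : prf -> tagged -> nat -> bool -> Prop) : Prop := {
  res_unbounded : unbounded I;
  res_live : forall d F n,
    Unav I (Adding F (fun F' => exists x, n < x /\ Out d F' x)) \/
    Avoid I (Adding F (fun F' => exists x, n < x /\ Out d F' x));
  res_Pos : forall d F x, Pos d F x -> Unav I (Adding F (fun F' => Out d F' x));
  res_Out : forall d F x, Out d F x -> Pos d F x;
  res_notPos : forall d F t x, srt F -> ~ Pos d F x ->
    ev I (fun a => ~ Pos d ((a, t) :: F) x);
  res_Rich : forall d F t, Rich d F t ->
    forall n, ev I (fun a => exists x, n < x /\ Pos d ((a, t) :: F) x);
  res_notRich : forall d F t, ~ Rich d F t ->
    exists n, ev I (fun a => forall x, n < x -> ~ Pos d ((a, t) :: F) x);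
  res_Q : forall d F x t, Q d F x t ->
    Unav I (Adding F (fun F' => Out d F' x /\ Rich d F' t));
  res_notQ : forall d F x t, ~ Q d F x t ->
    Avoid I (Adding F (fun F' => Out d F' x /\ Rich d F' t));
  res_notrichQ : forall d F t, ~ richQ I Q d F t ->
    exists n, ev I (fun a => forall x, n < x -> ~ Q d ((a, t) :: F) x t) }.

Lemma countable_index : countable (prf * tagged * nat * bool).
Proof.
  repeat apply countable_prod; auto using countable_prf, countable_nat, countable_bool.
  apply countable_list, countable_prod; auto using countable_nat, countable_bool.
Qed.

(** Four thinnings, each deciding questions phrased with the notions fixed by the previous ones:
    [I1] decides which outputs are unavoidable and defines [Pos]; [I2] decides what single elements
    make possible and defines [Rich]; [I3] decides [Q]; the last set decides what single elements
    make possible in the sense of [Q]. *)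
Lemma reservoir_exists : exists I Pos Rich Q, reservoir I Pos Rich Q.
Proof.
  destruct (fusion ((prf * tagged * nat * bool))
    (fun q => let '(d, F, n, b) := q in
       Adding F (fun F' => if b : bool then exists x, n < x /\ Out d F' x else Out d F' n))
    (fun _ => True) countable_index) as [I1 [_ [U1 D1]]].
  { intro n. exists n. auto. }
  pose (Pos d F x := Unav I1 (Adding F (fun F' => Out d F' x))).
  destruct (cohesive ((prf * tagged * nat * bool) * bool)
    (fun q a => let '(d, F, n, t, b) := q in
       if b : bool then exists x, n < x /\ Pos d ((a, t) :: F) x
       else Pos d ((a, t) :: F) n) I1) as [I2 [S2 [U2 D2]]]; auto.
  { apply countable_prod; [apply countable_index|apply countable_bool]. }
  pose (Rich d F t := forall n, ev I2 (fun a => exists x, n < x /\ Pos d ((a, t) :: F) x)).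
  destruct (fusion ((prf * tagged * nat * bool))
    (fun q => let '(d, F, x, t) := q in
       Adding F (fun F' => Out d F' x /\ Rich d F' t)) I2 countable_index U2)
    as [I3 [S3 [U3 D3]]].
  pose (Q d F x t := Unav I3 (Adding F (fun F' => Out d F' x /\ Rich d F' t))).
  destruct (cohesive (prf * tagged * nat * bool)
    (fun q a => let '(d, F, n, t) := q in exists x, n < x /\ Q d ((a, t) :: F) x t)
    I3 countable_index U3) as [I [S4 [U4 D4]]].
  assert (S42 : subset I I2) by (intros a Ha; auto).
  assert (S41 : subset I I1) by (intros a Ha; auto).
  exists I, Pos, Rich, Q. split; auto.
  - intros d F n. destruct (D1 (d, F, n, true)); [left|right].
    + now apply Unav_subset with I1.
    + now apply Avoid_subset with I1.
  - intros d F x H. now apply Unav_subset with I1.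
  - intros d F x H J _ _. exists []. simpl. repeat split; auto; intros b t [].
  - intros d F t x HF Hn. apply ev_subset with I2; auto.
    destruct (D2 (d, F, x, t, false)) as [H|H]; auto.
    (* If [x] is avoidable over [F] past [N], take [a] past [N] that makes it possible: a stage over
       [(a, t) :: F] that outputs [x] is also a stage over [F] that uses only elements past [N]. *)
    exfalso. destruct (D1 (d, F, x, false)) as [HU|[N HN]]; [now apply Hn|].
    destruct (ev_exists I2 _ U2 (ev_and _ _ _ H (ev_ge I2 (max N (bound F)))))
      as [a [Ha [HP Hle]]].
    destruct (HP (tail I1 N)) as [E [HE1 [HE2 [HE3 HE4]]]].
    + intros b [Hb _]; auto.
    + now apply tail_unbounded.
    + assert (Hs : srt (E ++ (a, t) :: F)).
      { apply srt_app. simpl. repeat split; auto. lia. }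
      apply (HN (E ++ [(a, t)])).
      * apply srt_app. simpl. repeat split; auto; try lia.
      * apply sub_app. split; auto. intros b t' [Hb|[]]. injection Hb as <- <-.
        split; [auto|lia].
      * replace (E ++ (a, t) :: F) with ((E ++ [(a, t)]) ++ F) in *
          by (now rewrite <- app_assoc).
        split; auto. now apply srt_app in Hs as [_ [_ Hs]].
  - intros d F t H n. now apply ev_subset with I2.
  - intros d F t H. apply not_all_ex_not in H as [n Hn]. exists n.
    apply ev_subset with I2; auto.
    destruct (D2 (d, F, n, t, true)) as [H|H]; [contradiction|].
    revert H. apply ev_imp. intros a _ H x Hx HP. apply H. eauto.
  - intros d F x t H. now apply Unav_subset with I3.
  - intros d F x t H. apply Avoid_subset with I3; auto.
    destruct (D3 (d, F, x, t)) as [H'|H']; auto. contradiction.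
  - intros d F t H. apply not_all_ex_not in H as [n Hn]. exists n.
    destruct (D4 (d, F, n, t)) as [H|H]; [contradiction|].
    revert H. apply ev_imp. intros a _ H x Hx HP. apply H. eauto.
Qed.

(** * Extensions of stages and ways to defeat a functional *)

Definition ext (J : nat -> Prop) (F' F : tagged) : Prop :=
  srt F' /\ exists E, F' = E ++ F /\ sub J E.

Lemma ext_refl J F : srt F -> ext J F F.
Proof. split; auto. exists []. split; auto. intros b t []. Qed.

Lemma ext_trans J F G H : ext J F G -> ext J G H -> ext J F H.
Proof.
  intros [H1 [E [-> HE]]] [H2 [E' [-> HE']]]. split; auto.
  exists (E ++ E'). split; [now rewrite app_assoc|]. apply sub_app; auto.
Qed.

Lemma ext_subset J I F G : subset J I -> ext J F G -> ext I F G.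
Proof.
  intros HS [H1 [E [-> HE]]]. split; auto. exists E. split; auto.
  now apply sub_mono with J.
Qed.

Lemma tail_subset I N : subset (tail I N) I.
Proof. intros a [H _]; auto. Qed.

Lemma ext_cons J a t F : J a -> bound F <= a -> srt F -> ext J ((a, t) :: F) F.
Proof.
  intros Ha Hb HF. split; [simpl; auto|]. exists [(a, t)]. split; auto.
  intros b t' [H|[]]. now injection H as <- <-.
Qed.

Lemma ext_Out J d F F' x : ext J F' F -> Out d F x -> Out d F' x.
Proof. intros [Hs [E [-> _]]]. now apply Out_app. Qed.

(** A homogeneous set for an extension of the condition contains no such [x], [y]. *)
Definition bad (r : cond) (x y : nat) : Prop :=
  lim r x <> lim r y \/ (x < y /\ col r x y <> lim r x).

Lemma bad_le r s x y : le s r -> x < len r -> y < len r -> bad r x y -> bad s x y.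
Proof.
  intros [H1 [H2 [H3 _]]] Hx Hy [H|[Hlt H]]; [left|right].
  - now rewrite !H3.
  - split; auto. rewrite H2 by lia. now rewrite H3.
Qed.

Section Side.

Variable e : prf.
Variable I : nat -> Prop.
Variable Pos : prf -> tagged -> nat -> Prop.
Variable Rich : prf -> tagged -> bool -> Prop.
Variable Q : prf -> tagged -> nat -> bool -> Prop.
Hypothesis RES : reservoir I Pos Rich Q.

(** Either way, [d] computes no infinite homogeneous set from an extension of [F]. *)
Definition wins (d : prf) (r : cond) (F : tagged) : Prop :=
  (exists n, forall F', ext I F' F -> forall x, n < x -> ~ Out d F' x) \/
  (exists x y, Out d F x /\ Out d F y /\ x < len r /\ y < len r /\ bad r x y).

(** Past some point, elements of [I] can no longer be given the limit color [c], so they cannot keep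
    feeding a solution of that color. *)
Definition Closed (c : bool) (r : cond) : Prop :=
  exists N, forall a, I a -> N <= a -> forall s M, le s r -> ~ dec e s a c M.

(** The situation to be refuted: the stage of color [c] can be prolonged forever, yet [d] is never
    defeated. The lemmas below derive consequences of this assumption until a contradiction
    appears. *)
Record OK (c : bool) (d : prf) (r : cond) (F : tagged) : Prop := {
  OK_alive : Alive e r;
  OK_open : forall s, le s r -> ~ Closed c s;
  OK_srt : srt F;
  OK_Adm : Adm e r c F;
  OK_nowin : forall s F', le s r -> ext I F' F -> Adm e s c F' -> ~ wins d s F' }.

Lemma OK_ext c d r F s F' :
  OK c d r F -> le s r -> ext I F' F -> Adm e s c F' -> OK c d s F'.
Proof.
  intros [H1 H2 H3 H4 H5] Hle Hext HA. split; auto.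
  - now apply Alive_le with r.
  - intros u Hu. apply H2. now apply le_trans with s.
  - apply Hext.
  - intros u F'' Hu HF''. apply H5; [now apply le_trans with s|].
    now apply ext_trans with F'.
Qed.

Lemma OK_le c d r F s : OK c d r F -> le s r -> OK c d s F.
Proof.
  intros H Hle. apply OK_ext with r F; auto.
  - apply ext_refl, H.
  - apply Adm_le with r; auto. apply H.
Qed.

Lemma open_elim c d r F : OK c d r F -> forall N, exists a s M,
  I a /\ N <= a /\ le s r /\ dec e s a c M.
Proof.
  intros H N. apply NNPP. intro Hn. apply (OK_open _ _ _ _ H r (le_refl r)).
  exists N. intros a Ha Hle s M Hs Hd. apply Hn. exists a, s, M. auto.
Qed.

(** Openness supplies arbitrarily late elements of limit color [c], which [Hom_step] collects into a
    pool. Unavoidability finds the required extension inside that pool, where every choice of sides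
    is admissible. *)
Lemma realize c d r F G N : OK c d r F -> Unav I (Adding F G) ->
  exists s F', le s r /\ ext (tail I N) F' F /\ OK c d s F' /\ G F'.
Proof.
  intros HOK HU.
  destruct (harvest cond (tail I N) (fun s A => le s r /\ Hom e s c A F) r (Adding F G))
    as [s [A [E [[Hs HH] [HE1 [HE2 [HE3 [HE4 HE5]]]]]]]].
  - split; [apply le_refl|apply Hom_nil].
  - intros s A [Hs HH]. assert (HOKs := OK_le _ _ _ _ _ HOK Hs).
    destruct (Hom_step e s c A F) as [N0 HN0]; auto; try apply HOKs.
    exists N0. intro n. destruct (open_elim _ _ _ _ HOKs (max n (max N N0)))
      as [a [u [M [Ha [Hle [Hu Hd]]]]]].
    destruct (HN0 a u M) as [u' [Hu' HH']]; auto; [lia|].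
    exists a, u'. split; [lia|]. split; [split; auto; lia|]. intros _. split; auto.
    apply le_trans with u; auto. now apply le_trans with s.
  - apply Unav_subset with I; auto. apply tail_subset.
  - assert (Hsrt : srt (E ++ F)) by (apply srt_app; repeat split; auto; apply HOK).
    assert (Hext : ext (tail I N) (E ++ F) F) by (split; eauto).
    exists s, (E ++ F). split; [|split; [|split]]; auto.
    apply OK_ext with r F; auto.
    + apply ext_subset with (tail I N); auto. apply tail_subset.
    + apply Hom_Adm with A; auto. apply Adm_le with r; auto. apply HOK.
Qed.

Lemma push c d r F N : OK c d r F ->
  exists s F', le s r /\ ext (tail I N) F' F /\ OK c d s F' /\ N <= bound F'.
Proof.
  intro HOK. apply (realize c d r F (fun F' => N <= bound F')); auto.
  intros J HJ HU. destruct (HU (max N (bound F))) as [a [Ha HJa]].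
  exists [(a, true)]. simpl. repeat split; auto; try lia.
  - intros b t [H|[]]. now injection H as <- <-.
  - intros b t [H|[]]. injection H as <- <-. lia.
  - simpl. lia.
Qed.

(** Otherwise large outputs are avoidable past some [N], and adding elements past [N] gives an
    admissible stage that wins by its first clause. *)
Lemma live c d r F n : OK c d r F ->
  Unav I (Adding F (fun F' => exists x, n < x /\ Out d F' x)).
Proof.
  intro HOK. destruct (res_live _ _ _ _ RES d F n) as [|[N HN]]; auto.
  (* A stage different from [F] contains a new element past [N], so everything added after it also
     lies past [N]. *)
  exfalso. destruct (realize c d r F (fun F' => F' <> F) N HOK) as [s [F' [H1 [H2 [H3 H4]]]]].
  { intros J HJ HU. destruct (HU (bound F)) as [a [Ha HJa]].
    exists [(a, true)]. simpl. repeat split; auto; try lia.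
    - intros b t [H|[]]. now injection H as <- <-.
    - intros b t [H|[]]. injection H as <- <-. lia.
    - intro H. apply (f_equal (@length _)) in H. simpl in H. lia. }
  apply (OK_nowin _ _ _ _ H3 s F' (le_refl s)).
  { apply ext_refl, H2. }
  { apply H3. }
  left. exists n. intros F'' [Hsrt [E' [-> HE']]] x Hx HO.
  destruct H2 as [H2 [E [-> HE]]]. rewrite app_assoc in *.
  apply (HN (E' ++ E)).
  - now apply srt_app in Hsrt as [Hsrt _].
  - apply sub_app. split; auto. intros b t Hb. split; [eauto|].
    destruct E as [|[a t'] E]; [now destruct H4|].
    assert (N <= a) by (eapply HE; left; eauto).
    rewrite <- app_assoc in Hsrt. apply srt_app in Hsrt as [_ [_ Hab]].
    specialize (Hab b t Hb). simpl in Hab. lia.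
  - split; [|eauto]. now apply srt_app in Hsrt as [_ [_ Hsrt]].
Qed.

(** A possible output is as harmful as an actual one: it can be realized in an admissible extension,
    where [x] and [z] form a bad pair of outputs. *)
Lemma win c d r F x z : OK c d r F -> Out d F x -> x < len r ->
  Pos d F z -> z < len r -> bad r x z -> False.
Proof.
  intros HOK HO Hx HP Hz Hb.
  destruct (realize c d r F (fun F' => Out d F' z) 0 HOK) as [s [F' [H1 [H2 [H3 H4]]]]].
  { apply RES; auto. }
  apply (OK_nowin _ _ _ _ H3 s F' (le_refl s)).
  - apply ext_refl, H2.
  - apply H3.
  - right. exists x, z. assert (Hl : len r <= len s) by apply H1.
    repeat split; auto; try lia.
    + eapply ext_Out; eauto.
    + now apply bad_le with r.
Qed.

(** Once an output lies below the length of the condition, its limit is fixed, and all further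
    outputs must have that same limit. *)
Lemma commit c d r F : OK c d r F ->
  exists s F' x, le s r /\ ext I F' F /\ OK c d s F' /\ Out d F' x /\ x < len s.
Proof.
  intro HOK. destruct (realize _ _ _ _ _ 0 HOK (live _ _ _ _ 0 HOK))
    as [s [F' [H1 [H2 [H3 [x [_ H4]]]]]]].
  destruct (le_extend s (S x) true) as [u [Hu [Hl _]]].
  exists u, F', x. split; [|split; [|split]]; auto.
  - now apply le_trans with s.
  - apply (ext_subset _ _ _ _ (tail_subset I 0) H2).
  - now apply OK_le with s.
Qed.

(** If no reachable stage were rich, a pool could be grown whose nonempty parts over [F] never make
    an output above a fixed [n] possible. This contradicts [live], by which outputs above [n] occur
    in every infinite pool. *)
Lemma finally_Rich c d r F : OK c d r F ->
  exists s F' t, le s r /\ ext I F' F /\ OK c d s F' /\ Rich d F' t.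
Proof.
  intro HOK. apply NNPP. intro Hn.
  assert (HnR : forall s E t, le s r -> srt (E ++ F) -> sub I E -> Adm e s c (E ++ F) ->
    ~ Rich d (E ++ F) t).
  { intros s E t Hs HE HEI HA HR. apply Hn. exists s, (E ++ F), t.
    assert (ext I (E ++ F) F) by (split; eauto).
    split; [|split; [|split]]; auto. now apply OK_ext with r F. }
  assert (HF := OK_srt _ _ _ _ HOK).
  assert (HnF : forall t, ~ Rich d F t).
  { intro t. apply (HnR r [] t); auto; [apply le_refl|intros b t' []|apply HOK]. }
  destruct (res_notRich _ _ _ _ RES d F true) as [n1 Hn1]; auto.
  destruct (res_notRich _ _ _ _ RES d F false) as [n2 Hn2]; auto.
  pose (n := max n1 n2).
  assert (Hbase : ev I (fun a => forall t x, n < x -> ~ Pos d ((a, t) :: F) x)).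
  { generalize (ev_and _ _ _ Hn1 Hn2). apply ev_imp. intros a _ [H1 H2] [] x Hx.
    - apply H1. lia.
    - apply H2. lia. }
  destruct (harvest cond I (fun s A => le s r /\ Hom e s c A F /\ (forall b, In b A -> I b) /\
      forall E, srt (E ++ F) -> sub (fun b => In b A) E -> E <> [] ->
      forall x, n < x -> ~ Pos d (E ++ F) x) r
      (Adding F (fun F' => exists x, n < x /\ Out d F' x)))
    as [s [A [E [[Hs [HH [HAI HA]]] [HE1 [HE2 [HE3 [HE4 [x [Hx HO]]]]]]]]]].
  - split; [apply le_refl|]. split; [apply Hom_nil|]. split; [intros b []|].
    intros [|[b t] E] _ HE HE0; [congruence|]. now destruct (HE b t (or_introl eq_refl)).
  - intros s A [Hs [HH [HAI HA]]]. assert (HOKs := OK_le _ _ _ _ _ HOK Hs).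
    destruct (Hom_step e s c A F) as [N0 HN0]; auto; try apply HOKs.
    destruct (list_bound nat (fun b N => b < N) A) as [m Hm].
    { intros; lia. } { intros b _. exists (S b). lia. }
    (* Only finitely many stages can be formed from the pool, so almost every new element is
       harmless over all of them at once. *)
    destruct (finite_tagged m) as [L HL].
    destruct (ev_list I tagged (fun E a => srt (E ++ F) -> sub (fun b => In b A) E ->
      forall t x, n < x -> ~ Pos d ((a, t) :: E ++ F) x) L) as [N1 HN1].
    { intros E _. destruct (classic (srt (E ++ F))) as [HE1|]; [|exists 0; tauto].
      destruct (classic (sub (fun b => In b A) E)) as [HE2|]; [|exists 0; tauto].
      destruct E as [|p E].
      - revert Hbase. apply ev_imp. auto.
      - remember (p :: E) as E'. assert (HE0 : E' <> []) by (subst; congruence).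
        assert (Ht : forall t, ev I (fun a => forall x, n < x ->
                                       ~ Pos d ((a, t) :: E' ++ F) x)).
        { intro t. destruct (res_notRich _ _ _ _ RES d (E' ++ F) t) as [n3 Hn3].
          { apply (HnR s); auto.
            - intros b t' Hb. apply HAI. exact (HE2 b t' Hb).
            - apply Hom_Adm with A; auto. apply HOKs. }
          (* Failure of richness only controls outputs above its own bound [n3]. The finitely many
             between [n] and [n3] are impossible over the current stage and are preserved one by one
             by [res_notPos]. *)
          assert (Hlow : ev I (fun a => forall x, x < S n3 -> n < x ->
                                       ~ Pos d ((a, t) :: E' ++ F) x)).
          { apply ev_below with (P := fun x a => n < x -> ~ Pos d ((a, t) :: E' ++ F) x).
            intros x Hx. destruct (le_lt_dec x n); [exists 0; intros; lia|].
            assert (Hev := res_notPos _ _ _ _ RES d (E' ++ F) t x HE1 (HA E' HE1 HE2 HE0 x l)).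
            revert Hev. apply ev_imp. auto. }
          generalize (ev_and _ _ _ Hlow Hn3). apply ev_imp. intros a _ [H1 H2] x Hx.
          destruct (le_lt_dec x n3); [apply H1; lia|apply H2; lia]. }
        generalize (ev_and _ _ _ (Ht true) (Ht false)). apply ev_imp.
        intros a _ [H1 H2] _ _ [] x Hx; auto. }
    exists (max N0 (max N1 m)). intro n0.
    destruct (open_elim _ _ _ _ HOKs (max n0 (max N0 (max N1 m))))
      as [a [u [M [Ha [Hle [Hu Hd]]]]]].
    destruct (HN0 a u M) as [u' [Hu' HH']]; auto; [lia|].
    exists a, u'. split; [lia|]. split; auto. intros _.
    split; [apply le_trans with u; auto; now apply le_trans with s|]. split; auto.
    split; [intros b [<-|Hb]; auto|].
    intros [|[b t] E] HE1 HE2 HE0 x Hx; [congruence|].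
    assert (HEA : sub (fun b => In b A) E).
    { intros b' t' Hb'. destruct (HE2 b' t' (or_intror Hb')) as [<-|]; auto. exfalso.
      assert (Hbb : a < b).
      { simpl in HE1. destruct HE1 as [H1 H2].
        assert (a < bound (E ++ F)); [|lia].
        apply srt_bound with t'; auto. apply in_or_app; auto. }
      destruct (HE2 b t (or_introl eq_refl)) as [|Hb]; [lia|]. specialize (Hm b Hb). lia. }
    destruct (HE2 b t (or_introl eq_refl)) as [<-|Hb].
    + simpl in HE1. apply HN1; auto; [lia| |apply HE1].
      assert (HEs : srt E) by (apply srt_app with (F := F), HE1).
      apply HL; auto. destruct E as [|[b' t'] E]; simpl; [lia|].
      apply Hm. apply (HEA b' t'). left; auto.
    + apply HA; auto. apply sub_cons; auto.
  - now apply live with c r.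
  (* The pool invariant covers only nonempty [E]; if [F] itself outputs [x], one added element
     contradicts [Hbase]. *)
  - destruct E as [|p E].
    + destruct (ev_exists I _ (res_unbounded _ _ _ _ RES)
        (ev_and _ _ _ Hbase (ev_ge I (bound F)))) as [a [Ha [Hb Hle]]].
      apply (Hb true x Hx). apply RES.
      apply (Out_app d [(a, true)] F); auto. simpl; auto.
    + apply (HA (p :: E)) with x; auto; [|congruence|apply RES; auto].
      apply srt_app; auto.
Qed.

(** Richness provides an element that makes some large [x] possible although [Q] fails for [x]. Once
    [x] is actually output, it stays output, so the failure of [Q] rules out richness on side [t] in
    all further extensions. *)
Lemma stop_Rich c d r F t : OK c d r F -> Rich d F t -> ~ richQ I Q d F t ->
  exists s F', le s r /\ ext I F' F /\ OK c d s F' /\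
    forall F'', ext I F'' F' -> ~ Rich d F'' t.
Proof.
  intros HOK HR HnR.
  destruct (res_notrichQ _ _ _ _ RES d F t HnR) as [n [N1 HN1]].
  destruct (res_Rich _ _ _ _ RES d F t HR n) as [N2 HN2].
  destruct (realize c d r F (fun F' => exists a x, F' = (a, t) :: F /\ n < x /\
      Pos d ((a, t) :: F) x) N1 HOK) as [s [F1 [H1 [H2 [H3 [a [x [-> [Hx HP]]]]]]]]].
  { intros J HJ HU. destruct (HU (max N2 (bound F))) as [a [Ha HJa]].
    destruct (HN2 a) as [x [Hx HP]]; [auto|lia|].
    exists [(a, t)]. simpl. repeat split; auto; try lia.
    - intros b t' [H|[]]. now injection H as <- <-.
    - intros b t' [H|[]]. injection H as <- <-. lia.
    - exists a, x. auto. }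
  assert (HNa : I a /\ N1 <= a).
  { destruct H2 as [_ [E [HE1 HE2]]]. change ([(a, t)] ++ F = E ++ F) in HE1.
    apply app_inv_tail in HE1. subst E. apply (HE2 a t). left; auto. }
  destruct HNa as [HIa HNa].
  destruct (res_notQ _ _ _ _ RES d ((a, t) :: F) x t (HN1 a HIa HNa x Hx)) as [N3 HN3].
  destruct (realize c d s ((a, t) :: F) (fun F' => Out d F' x) N3 H3)
    as [s2 [F2 [K1 [K2 [K3 K4]]]]].
  { apply RES; auto. }
  (* The avoidance behind the failure of [Q] holds only past [N3]; raising the bound of the stage
     puts all later elements there. *)
  destruct (push c d s2 F2 N3 K3) as [s3 [F3 [L1 [L2 [L3 L4]]]]].
  exists s3, F3. split; [|split; [|split]]; auto.
  - apply le_trans with s2; auto. now apply le_trans with s.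
  - apply ext_trans with F2; [apply (ext_subset _ _ _ _ (tail_subset I N3) L2)|].
    apply ext_trans with ((a, t) :: F).
    + apply (ext_subset _ _ _ _ (tail_subset I N3) K2).
    + apply (ext_subset _ _ _ _ (tail_subset I N1) H2).
  - intros F4 HF4 HT.
    assert (HO4 : Out d F4 x) by (eapply ext_Out; [exact HF4|]; eapply ext_Out; eauto).
    destruct HF4 as [Hsrt [E4 [-> HE4]]].
    destruct (ext_trans _ _ _ _ L2 K2) as [Hsrt3 [E3 [-> HE3]]].
    rewrite app_assoc in *. apply (HN3 (E4 ++ E3)).
    + now apply srt_app in Hsrt as [Hsrt _].
    + apply sub_app. split; auto. intros b t' Hb. split; [eauto|].
      rewrite <- app_assoc in Hsrt. apply srt_app in Hsrt as [_ [_ Hab]].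
      specialize (Hab b t' Hb). lia.
    + split; auto. now apply srt_app in Hsrt as [_ [_ Hsrt]].
Qed.

(** Otherwise richness could be stopped three times in succession, each time on a side not stopped
    before, but there are only two sides. *)
Lemma finally_richQ c d r F : OK c d r F ->
  exists s F' t, le s r /\ ext I F' F /\ OK c d s F' /\ richQ I Q d F' t.
Proof.
  intro HOK. apply NNPP. intro Hn.
  assert (Hstop : forall s F', le s r -> ext I F' F -> OK c d s F' ->
    exists s1 F1 F0 t, le s1 s /\ ext I F1 F' /\ OK c d s1 F1 /\
      ext I F0 F' /\ Rich d F0 t /\ forall F'', ext I F'' F1 -> ~ Rich d F'' t).
  { intros s F' Hs HF' HOK'.
    destruct (finally_Rich c d s F' HOK') as [s0 [F0 [t [K1 [K2 [K3 K4]]]]]].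
    destruct (stop_Rich c d s0 F0 t K3 K4) as [s1 [F1 [L1 [L2 [L3 L4]]]]].
    - intro HQ. apply Hn. exists s0, F0, t. split; [now apply le_trans with s|].
      split; auto. now apply ext_trans with F'.
    - exists s1, F1, F0, t. split; [now apply le_trans with s0|].
      split; [now apply ext_trans with F0|]. auto. }
  destruct (Hstop r F) as [s1 [F1 [G1 [t1 [A1 [A2 [A3 [A4 [A5 A6]]]]]]]]]; auto.
  { apply le_refl. } { apply ext_refl, HOK. }
  destruct (Hstop s1 F1) as [s2 [F2 [G2 [t2 [B1 [B2 [B3 [B4 [B5 B6]]]]]]]]]; auto.
  destruct (Hstop s2 F2) as [s3 [F3 [G3 [t3 [C1 [C2 [C3 [C4 [C5 C6]]]]]]]]]; auto.
  { now apply le_trans with s1. } { now apply ext_trans with F1. }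
  assert (t2 <> t1) by (intros ->; now apply (A6 G2)).
  assert (t3 <> t1) by (intros ->; apply (A6 G3); auto; now apply ext_trans with F2).
  assert (t3 <> t2) by (intros ->; now apply (B6 G3)).
  destruct t1, t2, t3; congruence.
Qed.

(** Once the output [x0] has committed the solution to a color, an element that makes
    possible an output of the other limit cannot join the solution. *)
Lemma force_other c d r F x0 : OK c d r F -> Out d F x0 -> x0 < len r ->
  exists N0, forall a s x t M, I a -> N0 <= a -> le s r -> Pos d ((a, t) :: F) x ->
    x < len s -> lim s x <> lim r x0 -> ~ dec e s a c M.
Proof.
  intros HOK HO Hx0.
  destruct (Hom_step e r c [] F) as [N0 HN0]; try apply HOK.
  { apply Hom_nil. }
  exists (max N0 (bound F)). intros a s x t M Ha Hle Hs HP Hx Hlim Hd.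
  destruct (HN0 a s M) as [s' [Hs' HH]]; auto; [lia|].
  assert (Hs'r : le s' r) by now apply le_trans with s.
  assert (Hext : ext I ((a, t) :: F) F) by (apply ext_cons; auto; [lia|apply HOK]).
  assert (HOK' : OK c d s' ((a, t) :: F)).
  { apply OK_ext with r F; auto.
    apply (Hom_Adm e s' c [a] [(a, t)] F); auto.
    - apply Adm_le with r; auto. apply HOK.
    - intros b t' [H|[]]. injection H as <- <-. left; auto.
    - apply Hext. }
  assert (L1 : len r <= len s') by apply Hs'r.
  assert (L2 : len s <= len s') by apply Hs'.
  apply (win c d s' ((a, t) :: F) x0 x); auto; try lia.
  - eapply ext_Out; eauto.
  - left. destruct Hs' as [_ [_ [E1 _]]], Hs'r as [_ [_ [E2 _]]].
    rewrite (E1 x), (E2 x0) by lia. congruence.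
Qed.

(** Aliveness decides some limit color for each element of [L], and [force_other] excludes [c]. *)
Lemma force_all c d r F x0 : OK c d r F -> Out d F x0 -> x0 < len r ->
  exists N0, forall s t L, le s r ->
    (forall a, In a L -> I a /\ N0 <= a /\ exists x, x < len s /\
       Pos d ((a, t) :: F) x /\ lim s x <> lim r x0) ->
    exists s', le s' s /\ forall a, In a L -> exists N, dec e s' a (negb c) N.
Proof.
  intros HOK HO Hx0. destruct (force_other c d r F x0 HOK HO Hx0) as [N0 HN0].
  exists N0. intros s t L Hs HL.
  destruct (all_decided e s L) as [s' [Hs' HD]].
  { apply Alive_le with r; auto. apply HOK. }
  exists s'. split; auto. intros a Ha. destruct (HD a Ha) as [c' [N HN]].
  exists N. destruct (Bool.bool_dec c' c) as [->|Hc].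
  - exfalso. destruct (HL a Ha) as [H1 [H2 [x [H3 [H4 H5]]]]].
    assert (L1 : len s <= len s') by apply Hs'.
    apply (HN0 a s' x t N); auto; [now apply le_trans with s|lia|].
    destruct Hs' as [_ [_ [E _]]]. now rewrite E.
  - replace (negb c) with c'; auto. destruct c, c'; simpl; congruence.
Qed.

(** A rich stage offers an element [a] that makes possible an output [x] whose limit is still free.
    Giving [x] a limit different from that of [x0] excludes color [c] for [a], and closedness
    excludes the other color, but aliveness decides one of them. *)
Lemma one_sided c d r F : OK c d r F -> ~ Closed (negb c) r.
Proof.
  intros HOK [N HN].
  destruct (commit c d r F HOK) as [s1 [F1 [x0 [A1 [A2 [A3 [A4 A5]]]]]]].
  destruct (finally_Rich c d s1 F1 A3) as [s2 [F2 [t [B1 [B2 [B3 B4]]]]]].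
  assert (L : len s1 <= len s2) by apply B1.
  assert (HO2 : Out d F2 x0) by (eapply ext_Out; eauto).
  destruct (force_other c d s2 F2 x0) as [N0 HN0]; auto; [lia|].
  destruct (ev_exists I _ (res_unbounded _ _ _ _ RES)
    (ev_and _ _ _ (res_Rich _ _ _ _ RES d F2 t B4 (len s2)) (ev_ge I (max N N0))))
    as [a [Ha [[x [Hx HP]] Hle]]].
  destruct (le_extend s2 (S x) (negb (lim s2 x0))) as [s3 [C1 [C2 C3]]].
  assert (Hr : le s3 r).
  { apply le_trans with s2; auto. now apply le_trans with s1. }
  destruct (proj2 (OK_alive _ _ _ _ HOK s3 Hr) a) as [s4 [c' [M [D1 D2]]]].
  destruct (Bool.bool_dec c' c) as [->|Hc].
  - apply (HN0 a s4 x t M); auto; [lia|now apply le_trans with s3| |].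
    + destruct D1. lia.
    + destruct D1 as [_ [_ [E _]]]. rewrite E, C3 by lia. now destruct (lim s2 x0).
  - apply (HN a Ha) with s4 M; [lia|now apply le_trans with s3|].
    replace (negb c) with c'; auto. destruct c, c'; simpl; congruence.
Qed.

(** * Playing the two colors against each other *)

(** While [x] is committed to the limit [b0], the elements [E] are chosen past the
    threshold of [a]; while it is committed to the limit [negb b0], the element [a'] is
    chosen past the thresholds of [E], and the pair [{x,z}] gets the color [negb b0].
    The elements can still be forced to have the limit color [false]: this depends only
    on the limits of their outputs for the other side. *)
Lemma two_sided_rich r d0 F0 t d1 F1 t1 x0 :
  OK false d0 r F0 -> richQ I Q d0 F0 t ->
  OK true d1 r F1 -> Out d1 F1 x0 -> x0 < len r -> Rich d1 F1 t1 -> False.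
Proof.
  intros HOK0 HQ HOK1 HO Hx0 HR.
  (* [b0] is the limit that is wrong for [d1]: an element that makes possible an output of limit
     [b0] on its side is forced to limit color [false]. *)
  pose (b0 := negb (lim r x0)).
  destruct (force_all true d1 r F1 x0 HOK1 HO Hx0) as [N1 HN1].
  assert (Hforce : forall s L, le s r ->
    (forall a, In a L -> I a /\ N1 <= a /\ exists x, x < len s /\
       Pos d1 ((a, t1) :: F1) x /\ lim s x = b0) ->
    exists s', le s' s /\ forall a, In a L -> exists N, dec e s' a false N).
  { intros s L Hs HL. apply (HN1 s t1 L Hs). intros a Ha.
    destruct (HL a Ha) as [H1 [H2 [x [H3 [H4 H5]]]]]. split; auto. split; auto.
    exists x. rewrite H5. unfold b0. repeat split; auto. now destruct (lim r x0). }
  clearbody b0. clear HN1.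
  assert (HA := OK_alive _ _ _ _ HOK0).
  destruct (Hom_step e r false [] F0) as [N2 HN2]; try apply HOK0; [apply Hom_nil|].
  destruct (ev_exists I _ (res_unbounded _ _ _ _ RES)
    (ev_and _ _ _ (ev_and _ _ _ (HQ (len r)) (res_Rich _ _ _ _ RES d1 F1 t1 HR (len r)))
       (ev_ge I (max (bound F0) (max N1 N2)))))
    as [a [Ha [[[x [Hx HQx]] [x' [Hx' HPx']]] Hle]]].
  destruct (le_extend r (S (max x x')) b0) as [rA0 [HrA0 [HlA HbA]]].
  (* Later switches act on the window from [len r] to [M1], which contains both [x] and [x']. *)
  pose (M1 := len rA0).
  assert (HxM : x < M1 /\ x' < M1) by (unfold M1; lia).
  destruct (Hforce rA0 [a] HrA0) as [rA1 [HrA1 HdA]].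
  { intros a1 [<-|[]]. split; auto. split; [lia|].
    exists x'. repeat split; auto; [apply HxM|]. apply HbA. lia. }
  destruct (HdA a (or_introl eq_refl)) as [NA HNA].
  destruct (HN2 a rA1 NA) as [rA [HrA HHA]]; auto; [lia|now apply le_trans with rA0|].
  assert (HrAr : le rA r).
  { apply le_trans with rA1; auto. now apply le_trans with rA0. }
  assert (HlAM : M1 <= len rA).
  { unfold M1. destruct HrA, HrA1. lia. }
  assert (HsF0 := OK_srt _ _ _ _ HOK0).
  pose (Fa := (a, t) :: F0).
  assert (HsFa : srt Fa) by (simpl; split; auto; lia).
  assert (HAa : Adm e rA false Fa).
  { apply (Hom_Adm e rA false [a] [(a, t)] F0); auto.
    - apply Adm_le with r; auto. apply HOK0.
    - intros b t' [H|[]]. injection H as <- <-. left; auto. }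
  (* The witness [y] lies outside the switched window, so a labelled element can be forced to color
     [false] under either setting of the window. *)
  pose (lab s b := exists y, M1 <= y /\ y < len s /\ Pos d1 ((b, t1) :: F1) y /\ lim s y = b0).
  assert (lab_le : forall s s' b, le s' s -> lab s b -> lab s' b).
  { intros s s' b Hs [y [H1 [H2 [H3 H4]]]]. exists y. destruct Hs as [E1 [_ [E2 _]]].
    repeat split; auto; [lia|]. now rewrite E2. }
  destruct (harvest cond I (fun s A => le s rA /\ Hom e s false A Fa /\
      forall b, In b A -> I b /\ N1 <= b /\ lab s b) rA
      (Adding Fa (fun F' => Out d0 F' x /\ Rich d0 F' t)))
    as [rho [A [E [[Hrho [HHrho HAl]] [HE1 [HE2 [HE3 [HE4 [HEx HER]]]]]]]]].
  { split; [apply le_refl|]. split; [apply Hom_nil|]. intros b []. }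
  { intros s A [Hs [HH HAl]].
    assert (Hsr : le s r) by now apply le_trans with rA.
    destruct (Hom_step e s false A Fa) as [N3 HN3]; auto.
    { now apply Alive_le with r. } { now apply Adm_le with rA. }
    destruct (res_Rich _ _ _ _ RES d1 F1 t1 HR (len s)) as [N4 HN4].
    exists 0. intro n.
    destruct (res_unbounded _ _ _ _ RES (max n (max N1 (max N3 N4)))) as [b [Hb HIb]].
    destruct (HN4 b HIb) as [y [Hy HPy]]; [lia|].
    destruct (le_extend s (S y) b0) as [s1 [Hs1 [Hl1 Hb1]]].
    destruct (Hforce s1 [b]) as [s2 [Hs2 Hd2]].
    { now apply le_trans with s. }
    { intros b' [<-|[]]. split; auto. split; [lia|]. exists y. repeat split; auto.
      apply Hb1. lia. }
    destruct (Hd2 b (or_introl eq_refl)) as [M HM].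
    destruct (HN3 b s2 M) as [s3 [Hs3 HH3]]; auto; [lia|now apply le_trans with s1|].
    assert (Hs31 : le s3 s1) by now apply le_trans with s2.
    assert (Hs3s : le s3 s) by now apply le_trans with s1.
    exists b, s3. split; [lia|]. split; auto. intros _.
    split; [now apply le_trans with s|]. split; auto.
    intros b' [<-|Hb'].
    - split; auto. split; [lia|]. apply lab_le with s1; auto. exists y.
      assert (len rA <= len s) by apply Hs.
      repeat split; auto; [lia|]. apply Hb1. lia.
    - destruct (HAl b' Hb') as [K1 [K2 K3]]. split; auto. split; auto.
      now apply lab_le with s. }
  { apply RES. exact HQx. }
  pose (Fy := E ++ Fa).
  assert (HsFy : srt Fy) by (apply srt_app; auto).
  assert (Hrhor : le rho r) by now apply le_trans with rA.
  assert (HAy : Adm e rho false Fy).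
  { apply Hom_Adm with A; auto. now apply Adm_le with rA. }
  (* The new condition extends [r] but need not extend [rA]. Computed values survive; the decision
     about [a] may be lost until the switch back, while the elements of [A] are decided again
     through their labels. *)
  pose (sB0 := switch (len r) M1 (negb b0) rho).
  assert (HsB0 : le sB0 r) by now apply switch_le.
  assert (HlabB : forall b, In b A -> lab sB0 b).
  { intros b Hb. destruct (HAl b Hb) as [_ [_ [y [K1 [K2 [K3 K4]]]]]].
    exists y. repeat split; auto. unfold sB0. now rewrite switch_out. }
  destruct (Hforce sB0 A HsB0) as [sB [HsB HdB]].
  { intros b Hb. destruct (HAl b Hb) as [K1 [K2 _]]. split; auto. split; auto.
    destruct (HlabB b Hb) as [y [_ Hy]]. eauto. }
  assert (HsBr : le sB r) by now apply le_trans with sB0.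
  assert (VB : forall p q k, Val e rho p q k -> Val e sB p q k).
  { intros p q k HV. apply Val_le with sB0; auto. }
  (* The old stage is [F0] and not [Fa]: [a] is not known to be decided here, and [a'] will join the
     same side as [a], so their pair needs no control. *)
  assert (HHB : Hom e sB false A F0).
  { split; auto. intros b b' Hb Hb' Hlt. apply VB. apply (proj2 HHrho); auto.
    destruct Hb' as [|[t' Hb']]; auto. right. exists t'. right; auto. }
  destruct (Hom_step e sB false A F0) as [N5 HN5]; auto.
  { now apply Alive_le with r. } { apply Adm_le with r; auto. apply HOK0. }
  destruct (ev_exists I _ (res_unbounded _ _ _ _ RES)
    (ev_and _ _ _ (ev_and _ _ _ (res_Rich _ _ _ _ RES d0 Fy t HER (len sB))
                                (res_Rich _ _ _ _ RES d1 F1 t1 HR (len sB)))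
       (ev_ge I (max (bound Fy) (max N1 N5)))))
    as [a' [Ha' [[[z [Hz HPz]] [y [Hy HPy]]] Hle']]].
  (* Here [x] has limit [negb b0] and [z] lies beyond [len sB], so [{x,z}] receives the color
     [negb b0]. The new points get limit [b0], which lets [y] force [a'] to color [false]. *)
  destruct (le_extend sB (S (max z y)) b0) as [sC0 [HsC0 [HlC HbC]]].
  assert (HsC0r : le sC0 r) by now apply le_trans with sB.
  assert (HMB : M1 <= len sB).
  { assert (len rA <= len rho) by apply Hrho. assert (len sB0 <= len sB) by apply HsB.
    simpl in *. lia. }
  destruct (Hforce sC0 [a'] HsC0r) as [sC1 [HsC1 HdC]].
  { intros b [<-|[]]. split; auto. split; [lia|]. exists y.
    repeat split; auto; [lia|]. apply HbC. lia. }
  destruct (HdC a' (or_introl eq_refl)) as [NC HNC].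
  destruct (HN5 a' sC1 NC) as [sC [HsC HHC]]; auto; [lia|now apply le_trans with sC0|].
  assert (HsCC0 : le sC sC0) by now apply le_trans with sC1.
  assert (HsCB : le sC sB) by now apply le_trans with sC0.
  assert (HsCr : le sC r) by now apply le_trans with sB.
  assert (HlC' : S (max z y) <= len sC) by (destruct HsCC0; lia).
  (* Switching back restores the limit [b0] of [x] and [x'] without changing the color of [{x,z}];
     now [a], [a'] and [A] can be forced to color [false] together. *)
  pose (sD0 := switch (len r) M1 b0 sC).
  assert (HsD0 : le sD0 r) by now apply switch_le.
  destruct (Hforce sD0 (a :: a' :: A) HsD0) as [sD [HsD HdD]].
  { intros b [<-|[<-|Hb]].
    - split; auto. split; [lia|]. exists x'. repeat split; auto.
      + simpl. lia.
      + apply switch_in; lia.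
    - split; auto. split; [lia|]. exists y. repeat split; auto.
      + simpl. lia.
      + unfold sD0. rewrite switch_out by lia.
        destruct HsCC0 as [_ [_ [K _]]]. rewrite K by lia. apply HbC. lia.
    - destruct (HAl b Hb) as [K1 [K2 _]]. split; auto. split; auto.
      assert (K3 : lab sC b).
      { apply lab_le with sB0; auto. now apply le_trans with sB. }
      destruct K3 as [y' [K3 [K4 [K5 K6]]]]. exists y'. repeat split; auto.
      unfold sD0. now rewrite switch_out. }
  assert (HsDr : le sD r) by now apply le_trans with sD0.
  assert (VD : forall p q k, Val e sC p q k -> Val e sD p q k).
  { intros p q k HV. apply Val_le with sD0; auto. }
  pose (F3 := (a', t) :: Fy).
  assert (HsF3 : srt F3) by (simpl; split; auto; lia).
  assert (HA3 : Adm e sD false F3).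
  { split.
    - intros b t' [Hb|Hb].
      + injection Hb as <- <-. apply HdD. right; left; auto.
      + apply in_app_or in Hb as [Hb|[Hb|Hb]].
        * apply HdD. right; right. exact (HE2 b t' Hb).
        * injection Hb as <- <-. apply HdD. left; auto.
        * destruct (proj1 (OK_Adm _ _ _ _ HOK0) b t' Hb) as [N HN].
          exists N. now apply dec_le with r N.
    - intros p q tp tq [Hp|Hp] [Hq|Hq] Hne Hlt.
      + injection Hp as <- <-. injection Hq as <- <-. lia.
      + injection Hp as <- <-. assert (K := srt_bound _ _ _ HsFy Hq). lia.
      + injection Hq as <- <-. apply VD. apply (proj2 HHC); auto; [left; auto|].
        apply in_app_or in Hp as [Hp|[Hp|Hp]].
        * left; right. exact (HE2 p tp Hp).
        (* This is the pair of [a] and [a'], exempt because both carry the tag [t]. *)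
        * injection Hp as <- <-. congruence.
        * right. eauto.
      + apply VD. apply Val_le with sB; auto. apply VB.
        now apply (proj2 HAy) with tp tq. }
  assert (Hext3 : ext I F3 F0).
  { apply ext_trans with Fy; [apply ext_cons; auto; lia|].
    apply ext_trans with Fa; [split; [auto|now exists E]|].
    apply ext_cons; auto; lia. }
  assert (HOK3 : OK false d0 sD F3) by now apply OK_ext with r F0.
  assert (HlD : len sC <= len sD) by apply HsD.
  apply (win false d0 sD F3 x z); auto; try lia.
  - apply (Out_app d0 [(a', t)] Fy); auto.
  - right. split; [lia|].
    destruct HsD as [_ [K1 [K2 _]]]. rewrite K2 by (simpl; lia).
    rewrite K1 by (simpl; lia). unfold sD0. rewrite switch_in by lia. simpl.
    destruct HsCB as [_ [_ [_ K3]]]. rewrite K3 by lia.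
    destruct HsB as [_ [_ [K4 _]]].
    assert (M1 <= len sB0) by (assert (len rA <= len rho) by apply Hrho; simpl; lia).
    rewrite K4 by lia.
    unfold sB0. rewrite switch_in by lia. now destruct b0.
Qed.

Lemma two_sided r d0 F0 d1 F1 : OK false d0 r F0 -> OK true d1 r F1 -> False.
Proof.
  intros HOK0 HOK1.
  destruct (finally_richQ _ _ _ _ HOK0) as [s1 [G0 [t [A1 [A2 [A3 A4]]]]]].
  destruct (commit true d1 s1 F1) as [s2 [G1 [x0 [B1 [B2 [B3 [B4 B5]]]]]]].
  { now apply OK_le with r. }
  destruct (finally_Rich _ _ _ _ B3) as [s3 [G2 [t1 [C1 [C2 [C3 C4]]]]]].
  apply (two_sided_rich s3 d0 G0 t d1 G2 t1 x0); auto.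
  - apply OK_le with s1; auto. now apply le_trans with s2.
  - eapply ext_Out; eauto.
  - destruct C1. lia.
Qed.

(** Aliveness decides every element of [I], so when [negb c] is closed, [c] stays open in every
    extension. Without a win this would be the situation refuted by [one_sided]. *)
Lemma wins_if_Closed c d r F : Alive e r -> srt F -> Adm e r c F -> Closed (negb c) r ->
  exists s F', le s r /\ ext I F' F /\ Adm e s c F' /\ wins d s F'.
Proof.
  intros HA HF HAdm HC. apply NNPP. intro Hn.
  apply (one_sided c d r F); auto. split; auto.
  - intros s Hs [N HN]. destruct HC as [N' HN'].
    destruct (res_unbounded _ _ _ _ RES (max N N')) as [a [Hle Ha]].
    destruct (proj2 (HA s Hs) a) as [u [c' [M [Hu Hd]]]].
    destruct (Bool.bool_dec c' c) as [->|Hc].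
    + apply (HN a Ha) with u M; auto. lia.
    + apply (HN' a Ha) with u M; [lia|now apply le_trans with s|].
      replace (negb c) with c'; auto. destruct c, c'; simpl; congruence.
  - intros s F' H1 H2 H3 H4. apply Hn. exists s, F'. auto.
Qed.

(** If some extension closes a color, the opposite side wins there. Otherwise both colors stay open,
    and the absence of a win on either side contradicts [two_sided]. *)
Lemma wins_some_side r (d : bool -> prf) (F : bool -> tagged) : Alive e r ->
  (forall c, srt (F c) /\ Adm e r c (F c)) ->
  exists c s F', le s r /\ ext I F' (F c) /\ Adm e s c F' /\ wins (d c) s F'.
Proof.
  intros HA HF.
  destruct (classic (exists c s, le s r /\ Closed (negb c) s)) as [[c [s [Hs HC]]]|Hn].
  - destruct (HF c) as [H1 H2].
    destruct (wins_if_Closed c (d c) s (F c)) as [u [F' [H3 [H4 [H5 H6]]]]]; auto.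
    { now apply Alive_le with r. } { now apply Adm_le with r. }
    exists c, u, F'. split; [now apply le_trans with s|auto].
  - apply NNPP. intro Hw.
    assert (HOK : forall c, OK c (d c) r (F c)).
    { intro c. split; auto; try apply HF.
      - intros s Hs HC. apply Hn. exists (negb c), s. rewrite Bool.negb_involutive. auto.
      - intros s F' H1 H2 H3 H4. apply Hw. exists c, s, F'. auto. }
    apply (two_sided r (d false) (F false) (d true) (F true)); auto.
Qed.

End Side.

(** * The generic coloring *)

(** Stages are indexed by the functional [e] computing the instance and by the color, but not by
    [d]: a single solution has to face all functionals [d]. *)
Record state (I : nat -> Prop) := {
  st_cond : cond;
  st_stage : prf -> bool -> tagged;
  st_ok : forall e c, srt (st_stage e c) /\ Adm e st_cond c (st_stage e c) }.

Arguments st_cond {I}.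
Arguments st_stage {I}.
Arguments st_ok {I}.

Definition sle {I} (u v : state I) : Prop :=
  le (st_cond u) (st_cond v) /\ forall e c, ext I (st_stage u e c) (st_stage v e c).

Lemma sle_refl I (u : state I) : sle u u.
Proof. split; [apply le_refl|]. intros e c. apply ext_refl, st_ok. Qed.

Lemma sle_trans I (u v w : state I) : sle u v -> sle v w -> sle u w.
Proof.
  intros [H1 H2] [H3 H4]. split; [now apply le_trans with (st_cond v)|].
  intros e c. now apply ext_trans with (st_stage v e c).
Qed.

Lemma extend_cond I (u : state I) r : le r (st_cond u) ->
  exists v, sle v u /\ st_cond v = r.
Proof.
  intro Hr.
  assert (Hok : forall e c, srt (st_stage u e c) /\ Adm e r c (st_stage u e c)).
  { intros e c. destruct (st_ok u e c). split; auto. now apply Adm_le with (st_cond u). }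
  exists {| st_cond := r; st_stage := st_stage u; st_ok := Hok |}.
  split; auto. split; auto. intros e c. apply ext_refl, st_ok.
Qed.

Lemma extend_stage I (u : state I) e c r F : le r (st_cond u) ->
  ext I F (st_stage u e c) -> Adm e r c F ->
  exists v, sle v u /\ st_cond v = r /\ st_stage v e c = F.
Proof.
  intros Hr HF HA.
  pose (FF e' c' := if excluded_middle_informative (e' = e /\ c' = c) then F
                    else st_stage u e' c').
  assert (Hok : forall e c, srt (FF e c) /\ Adm e r c (FF e c)).
  { intros e' c'. unfold FF. destruct (excluded_middle_informative _) as [[-> ->]|_].
    - split; auto. apply HF.
    - destruct (st_ok u e' c'). split; auto. now apply Adm_le with (st_cond u). }
  exists {| st_cond := r; st_stage := FF; st_ok := Hok |}. split; [|split]; simpl; auto.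
  - split; auto. intros e' c'. simpl. unfold FF.
    destruct (excluded_middle_informative _) as [[-> ->]|_]; auto.
    apply ext_refl, st_ok.
  - unfold FF. destruct (excluded_middle_informative _) as [_|Hn]; auto.
    now destruct Hn.
Qed.

Inductive req :=
| RAlive (e : prf)
| RLen (n : nat)
| RDec (e : prf) (a N : nat) (c : bool)
| RExt (e : prf) (c t : bool) (N : nat)
| RWin (e : prf) (c : bool) (d : prf)
| RWins (e d0 d1 : prf).

Lemma countable_req : countable req.
Proof.
  apply countable_inj with (T := (nat * prf * prf * prf * nat * nat * bool * bool)%type)
    (g := fun q => match q with
      | RAlive e => (0, e, e, e, 0, 0, true, true)
      | RLen n => (1, PZero, PZero, PZero, n, 0, true, true)
      | RDec e a N c => (2, e, e, e, a, N, c, true)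
      | RExt e c t N => (3, e, e, e, N, 0, c, t)
      | RWin e c d => (4, e, d, d, 0, 0, c, true)
      | RWins e d0 d1 => (5, e, d0, d1, 0, 0, true, true)
      end).
  - intros [] [] H; try discriminate; injection H; intros; subst; auto.
  - repeat apply countable_prod; auto using countable_prf, countable_nat, countable_bool.
Qed.

(** [RAlive] and [RDec] describe failures: they are shown not to be met, and genericity then gives a
    condition below which the failure is impossible. [RWin] serves when one color is closed, [RWins]
    when both stay open. *)
Definition meets (I : nat -> Prop) (q : req) (u : state I) : Prop :=
  let r := st_cond u in
  match q with
  | RAlive e =>
      (exists a v, a < v /\ forall s k, le s r -> ~ Val e s a v k) \/
      (exists a, forall s c N, le s r -> ~ dec e s a c N)
  | RLen n => n <= len r
  | RDec e a N c => exists v k, N <= v /\ a < v /\ k <> Nat.b2n c /\ Val e r a v k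
  | RExt e c t N => exists a, N <= a /\ In (a, t) (st_stage u e c)
  | RWin e c d => wins I d r (st_stage u e c)
  | RWins e d0 d1 =>
      wins I d0 r (st_stage u e false) \/ wins I d1 r (st_stage u e true)
  end.

Section Generic.

Variable I : nat -> Prop.
Variable Pos : prf -> tagged -> nat -> Prop.
Variable Rich : prf -> tagged -> bool -> Prop.
Variable Q : prf -> tagged -> nat -> bool -> Prop.
Hypothesis RES : reservoir I Pos Rich Q.

Variable s : nat -> state I.
Hypothesis s_dec : forall i j, i <= j -> sle (s j) (s i).
Hypothesis s_generic :
  forall q, exists k, meets I q (s k) \/ ~ exists u, sle u (s k) /\ meets I q u.

Let r k := st_cond (s k).

Lemma r_le i j : i <= j -> le (r j) (r i).
Proof. intro H. now apply s_dec. Qed.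

Lemma r_len n : exists k, n <= len (r k).
Proof.
  destruct (s_generic (RLen n)) as [k [H|H]]; [eauto|].
  exfalso. apply H. destruct (le_extend (r k) n true) as [r' [H1 [H2 _]]].
  destruct (extend_cond I (s k) r' H1) as [u [Hu <-]]. exists u. auto.
Qed.

Lemma generic_coloring : exists X, forall k, mem (r k) X.
Proof.
  pose (j n := proj1_sig (constructive_indefinite_description _ (r_len n))).
  assert (Hj : forall n, n <= len (r (j n))).
  { intro n. exact (proj2_sig (constructive_indefinite_description _ (r_len n))). }
  exists (fun x y => col (r (j (S y))) x y). intro k. split.
  - intros x y Hx Hy. specialize (Hj (S y)).
    destruct (le_lt_dec (j (S y)) k) as [H|H].
    + symmetry. apply (le_agree _ _ (r_le _ _ H)); lia.
    + apply (le_agree (r (j (S y))) (r k)); auto. apply r_le. lia.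
  - intros x y Hx Hy. specialize (Hj (S y)).
    destruct (le_lt_dec (j (S y)) k) as [H|H].
    + assert (len (r (j (S y))) <= len (r k)) by apply (r_le _ _ H). lia.
    + destruct (r_le k (j (S y))) as [_ [_ [_ H']]]; [lia|]. apply H'; lia.
Qed.

Variable X : coloring.
Hypothesis X_mem : forall k, mem (r k) X.

Lemma X_stable : stable X.
Proof.
  intro x. destruct (r_len (S x)) as [k Hk]. exists (lim (r k) x), (len (r k)).
  intros u Hu _. apply (X_mem k); auto.
Qed.

Lemma Val_true e k a u v : Val e (r k) a u v -> Phi e X a u v.
Proof. intro H. apply H. apply (X_mem k). Qed.

Lemma true_Val e a u v : Phi e X a u v -> exists k, Val e (r k) a u v.
Proof.
  intro H. destruct (Phi_use _ _ _ _ _ H) as [n Hn]. destruct (r_len n) as [k Hk].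
  exists k. intros Y HY. apply Hn. intros x y Hx Hy. rewrite HY by lia.
  symmetry. apply (X_mem k); lia.
Qed.

Variable e : prf.
Variable Xh : coloring.
Hypothesis Xh_stable : stable Xh.
Hypothesis Xh_Phi : forall a u, a < u -> Phi e X a u (Nat.b2n (Xh a u)).

Let F c k := st_stage (s k) e c.

Lemma F_ext c i j : i <= j -> ext I (F c j) (F c i).
Proof. intro H. now apply s_dec. Qed.

(** With [c] and [N] taken from the true limit, meeting [RDec] would give [Xh] a wrong value beyond
    [N]. Hence some condition has no extension producing such a value. *)
Lemma eventually_decided a : exists k c N, dec e (r k) a c N.
Proof.
  destruct (Xh_stable a) as [c [N HN]].
  destruct (s_generic (RDec e a N c)) as [k [[u [v [H1 [H2 [H3 H4]]]]]|H]].
  - exfalso. apply H3. apply Val_true in H4.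
    rewrite (Phi_det _ _ _ _ _ _ H4 (Xh_Phi a u H2)). now rewrite HN.
  - exists k, c, N. intros Y HY u v Hu Ha HP. apply NNPP. intro Hv. apply H.
    destruct (Phi_use _ _ _ _ _ HP) as [n Hn].
    (* Copying [Y] up to the use of the computation turns the value computed from [Y] into a [Val]
       of an extension. *)
    destruct (extend_cond I (s k)
      (restrict (r k) Y (max n (len (r k))) (fun _ => true))) as [w [Hw Heq]].
    { apply restrict_le; auto. unfold r. lia. }
    exists w. split; auto. simpl. rewrite Heq. exists u, v. repeat split; auto.
    intros Z HZ. apply Hn. intros x y Hx Hy. apply HZ; simpl; lia.
Qed.

Lemma eventually_Alive : exists k, Alive e (r k).
Proof.
  destruct (s_generic (RAlive e)) as [k [[[a [u [Hlt H]]]|[a H]]|H]].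
  - exfalso. destruct (true_Val _ _ _ _ (Xh_Phi a u Hlt)) as [j Hj].
    apply (H (r (max k j)) (Nat.b2n (Xh a u))); [apply r_le; lia|].
    apply Val_le with (r j); auto. apply r_le. lia.
  - exfalso. destruct (eventually_decided a) as [j [c [N HN]]].
    apply (H (r (max k j)) c N); [apply r_le; lia|].
    apply dec_le with (r j) N; auto. apply r_le. lia.
  - exists k. intros t Ht. destruct (extend_cond I (s k) t Ht) as [w [Hw <-]].
    split.
    + intros a u Hlt. apply NNPP. intro Hn. apply H. exists w. split; auto.
      left. exists a, u. split; auto. intros t' v Ht' HV. apply Hn. eauto.
    + intros a. apply NNPP. intro Hn. apply H. exists w. split; auto.
      right. exists a. intros t' c N Ht' HV. apply Hn. exists t', c, N. auto.
Qed.

Lemma not_both_Closed c k k' : Closed e I c (r k) -> Closed e I (negb c) (r k') -> False.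
Proof.
  intros [N HN] [N' HN']. destruct (res_unbounded _ _ _ _ RES (max N N')) as [a [Hle Ha]].
  destruct (eventually_decided a) as [j [c' [M HM]]].
  assert (HM' : dec e (r (max j (max k k'))) a c' M).
  { apply dec_le with (r j) M; auto. apply r_le. lia. }
  destruct (Bool.bool_dec c' c) as [->|Hc].
  - apply (HN a Ha) with (r (max j (max k k'))) M; [lia|apply r_le; lia|auto].
  - apply (HN' a Ha) with (r (max j (max k k'))) M; [lia|apply r_le; lia|].
    replace (negb c) with c'; auto. destruct c, c'; simpl; congruence.
Qed.

(** Openness always yields a late element that can be decided to have color [c], and [Hom_step] lets
    it join on the prescribed side; so [RExt] cannot be unmeetable. *)
Lemma stages_grow c : (forall k, ~ Closed e I c (r k)) ->
  forall t N, exists k a, N <= a /\ In (a, t) (F c k).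
Proof.
  intros HC t N. destruct (s_generic (RExt e c t N)) as [k [[a Ha]|H]]; [eauto|].
  exfalso. destruct eventually_Alive as [k0 Hk0].
  pose (j := max k k0).
  assert (HA : Alive e (r j)).
  { apply Alive_le with (r k0); auto. apply r_le. unfold j; lia. }
  destruct (st_ok (s j) e c) as [Hsrt HAdm].
  destruct (Hom_step e (r j) c [] (F c j)) as [N0 HN0]; auto; [apply Hom_nil|].
  assert (Hex : exists a t' M, I a /\ max N (max N0 (bound (F c j))) <= a /\ le t' (r j) /\
            dec e t' a c M).
  { apply NNPP. intro Hn. apply (HC j). exists (max N (max N0 (bound (F c j)))).
    intros a Ha Hle t' M Ht' Hd. apply Hn. exists a, t', M. auto. }
  destruct Hex as [a [t1 [M [Ha [Hle [Ht1 Hd]]]]]].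
  destruct (HN0 a t1 M) as [t2 [Ht2 HH]]; auto; [lia|].
  assert (Ht2' : le t2 (r j)) by now apply le_trans with t1.
  assert (Hext : ext I ((a, t) :: F c j) (F c j)) by (apply ext_cons; auto; lia).
  destruct (extend_stage I (s j) e c t2 ((a, t) :: F c j)) as [w [Hw [_ Hw']]]; auto.
  { apply (Hom_Adm e t2 c [a] [(a, t)] (F c j)); auto.
    - now apply Adm_le with (r j).
    - intros b t' [Hb|[]]. injection Hb as <- <-. left; auto.
    - apply Hext. }
  apply H. exists w. split; [apply sle_trans with (s j); auto; apply s_dec; unfold j; lia|].
  exists a. split; [lia|]. rewrite Hw'. left; auto.
Qed.

Definition limit_set (c t : bool) (a : nat) : bool :=
  if excluded_middle_informative (exists k, In (a, t) (F c k)) then true else false.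

Lemma limit_setP c t a : limit_set c t a = true <-> exists k, In (a, t) (F c k).
Proof.
  unfold limit_set. destruct (excluded_middle_informative _); split; auto; congruence.
Qed.

Lemma follows_limit c k : follows (limit_set c) (F c k).
Proof.
  intros t a Ha. split.
  - intro H. apply limit_setP in H as [j Hj]. destruct (le_lt_dec j k) as [Hle|Hlt].
    + destruct (F_ext c j k Hle) as [_ [E [-> _]]]. apply in_or_app; auto.
    + destruct (F_ext c k j) as [Hs [E [HE _]]]; [lia|]. rewrite HE in *.
      apply in_app_or in Hj as [Hj|]; auto.
      apply srt_app in Hs as [_ [_ Hs]]. specialize (Hs a t Hj). lia.
  - intro H. apply limit_setP. eauto.
Qed.

Lemma limit_solution c : (forall k, ~ Closed e I c (r k)) ->
  p_homogeneous Xh (join (limit_set c true) (limit_set c false)).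
Proof.
  intro HC. exists (limit_set c true), (limit_set c false). split; auto.
  assert (Hinf : forall t, infinite (limit_set c t)).
  { intros t n. destruct (stages_grow c HC t n) as [k [a [Ha Hin]]].
    exists a. split; auto. apply limit_setP. eauto. }
  split; auto. split; auto. exists c.
  assert (Hpair : forall a b t t', limit_set c t a = true -> limit_set c t' b = true ->
    t <> t' -> a < b -> Xh a b = c).
  { intros a b t t' Ha Hb Ht Hlt. apply limit_setP in Ha as [i Hi].
    apply limit_setP in Hb as [j Hj].
    destruct (F_ext c i (max i j)) as [_ [E [HE _]]]; [lia|].
    destruct (F_ext c j (max i j)) as [_ [E' [HE' _]]]; [lia|].
    destruct (st_ok (s (max i j)) e c) as [_ [_ HV]].
    assert (HV' : Val e (r (max i j)) a b (Nat.b2n c)).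
    { apply HV with t t'; auto; fold (F c (max i j)).
      - rewrite HE. apply in_or_app; auto.
      - rewrite HE'. apply in_or_app; auto. }
    apply Val_true in HV'. assert (K := Phi_det _ _ _ _ _ _ HV' (Xh_Phi a b Hlt)).
    now destruct (Xh a b), c. }
  intros x y Hx Hy Hxy. unfold fpair. destruct (x <? y) eqn:E.
  - apply Nat.ltb_lt in E. now apply (Hpair x y true false).
  - apply Nat.ltb_ge in E. apply (Hpair y x false true); auto. lia.
Qed.

(** An infinite [Y] has elements above any [n], and by the use principle a later stage outputs them,
    refuting the first clause. Outputs belong to [Y], and comparing them with late elements of [Y]
    shows that their limits equal its color [c0], so no pair of them is bad. *)
Lemma computed_never_wins c d Y : (forall k, ~ Closed e I c (r k)) ->
  homogeneous X Y ->
  (forall n, eval (set_code (join (limit_set c true) (limit_set c false))) d [n]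
               (set_code Y n)) ->
  forall k, ~ wins I d (r k) (F c k).
Proof.
  intros HC [HYinf [c0 HY]] Hd k.
  assert (HYx : forall x, Y x = true ->
    eval (set_code (join (limit_set c true) (limit_set c false))) d [x] 1).
  { intros x Hx. specialize (Hd x). unfold set_code at 2 in Hd. now rewrite Hx in Hd. }
  intros [[n Hn]|[x [y [HOx [HOy [Hx [Hy Hbad]]]]]]].
  - destruct (HYinf (S n)) as [x [Hnx Hx]].
    destruct (Out_use _ _ _ (HYx x Hx)) as [m Hm].
    destruct (stages_grow c HC true m) as [j [a [Ha Hin]]].
    assert (HF := F_ext c k (max j k) ltac:(lia)).
    apply (Hn (F c (max j k)) HF x); [lia|]. apply Hm; [|apply follows_limit].
    destruct (F_ext c j (max j k)) as [Hs [E [HE _]]]; [lia|]. rewrite HE in *.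
    assert (K1 := bound_app _ _ Hs). apply srt_app in Hs as [_ [Hs _]].
    assert (K2 := srt_bound _ _ _ Hs Hin). lia.
  - assert (HY' : forall x, Out d (F c k) x -> Y x = true).
    { intros x' HO. assert (K := eval_det _ _ _ _ _ (HO _ (follows_limit c k)) (Hd x')).
      unfold set_code in K. now destruct (Y x'). }
    assert (Hlim : forall x, Out d (F c k) x -> x < len (r k) -> lim (r k) x = c0).
    { intros x' HO Hx'. destruct (HYinf (len (r k))) as [w [Hw HYw]].
      rewrite <- (proj2 (X_mem k) x' w) by lia. apply HY; auto. lia. }
    destruct Hbad as [Hbad|[Hlt Hbad]].
    + apply Hbad. now rewrite !Hlim.
    + apply Hbad. rewrite Hlim; auto. rewrite <- (proj1 (X_mem k)); auto.
Qed.

(** Every color that stays open gives a solution, and the reduction gives a functional [d] that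
    never loses on it. If one color gets closed, [RWin] for the other is violated; if none does,
    [RWins] for the two functionals is. *)
Lemma no_reduction :
  ~ forall Yh, p_homogeneous Xh Yh ->
      exists Y, homogeneous X Y /\ Tred (set_code Y) (set_code Yh).
Proof.
  intro Hred. destruct eventually_Alive as [k0 Hk0].
  assert (Hside : forall c, (forall k, ~ Closed e I c (r k)) ->
    exists d, forall k, ~ wins I d (r k) (F c k)).
  { intros c HC. destruct (Hred _ (limit_solution c HC)) as [Y [HY [d Hd]]].
    exists d. now apply computed_never_wins with Y. }
  assert (Hal : forall k, k0 <= k -> Alive e (r k)).
  { intros k Hk. apply Alive_le with (r k0); auto. now apply r_le. }
  destruct (classic (exists c k, Closed e I (negb c) (r k))) as [[c [k1 HC]]|Hn].
  - destruct (Hside c) as [d Hd].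
    { intros k Hk. now apply (not_both_Closed c k k1). }
    destruct (s_generic (RWin e c d)) as [k [H|H]]; [now apply (Hd k)|].
    pose (j := max k (max k0 k1)). destruct (st_ok (s j) e c) as [H1 H2].
    destruct (wins_if_Closed e I Pos Rich Q RES c d (r j) (F c j))
      as [t [F' [K1 [K2 [K3 K4]]]]]; auto.
    { apply Hal. unfold j; lia. }
    { destruct HC as [N HN]. exists N. intros a Ha Hle t M Ht. apply HN; auto.
      apply le_trans with (r j); auto. apply r_le. unfold j; lia. }
    destruct (extend_stage I (s j) e c t F') as [w [Hw [Hw1 Hw2]]]; auto.
    apply H. exists w. split; [apply sle_trans with (s j); auto; apply s_dec; unfold j; lia|].
    simpl. now rewrite Hw1, Hw2.
  - assert (HC : forall c k, ~ Closed e I c (r k)).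
    { intros c k Hk. apply Hn. exists (negb c), k. now rewrite Bool.negb_involutive. }
    destruct (Hside false (HC false)) as [d0 Hd0], (Hside true (HC true)) as [d1 Hd1].
    destruct (s_generic (RWins e d0 d1)) as [k [[H|H]|H]];
      [now apply (Hd0 k)|now apply (Hd1 k)|].
    pose (j := max k k0).
    destruct (wins_some_side e I Pos Rich Q RES (r j)
      (fun c : bool => if c then d1 else d0) (fun c => F c j))
      as [c [t [F' [K1 [K2 [K3 K4]]]]]].
    { apply Hal. unfold j; lia. }
    { intro c. apply (st_ok (s j)). }
    destruct (extend_stage I (s j) e c t F') as [w [Hw [Hw1 Hw2]]]; auto.
    apply H. exists w. split; [apply sle_trans with (s j); auto; apply s_dec; unfold j; lia|].
    simpl. rewrite Hw1. destruct c; rewrite Hw2; auto.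
Qed.

End Generic.

Theorem theorem1p8 : ~ sc_le SRT22 SPT22.
Proof.
  intro Hsc. destruct reservoir_exists as [I [Pos [Rich [Q RES]]]].
  (* A condition of length 0 constrains nothing, so its colors and limits are arbitrary. *)
  pose (r0 := {| len := 0; col := fun _ _ => true; lim := fun _ => true |}).
  assert (Hok : forall e c, srt ((fun (_ : prf) (_ : bool) => []) e c) /\
    Adm e r0 c ((fun (_ : prf) (_ : bool) => []) e c)).
  { intros e c. split; [exact Logic.I|apply Adm_nil]. }
  destruct (generic_sequence (state I) req sle (meets I)
    {| st_cond := r0; st_stage := fun _ _ => []; st_ok := Hok |}) as [s [_ [Hs Hgen]]].
  { apply sle_refl. } { apply sle_trans. } { apply countable_req. }
  destruct (generic_coloring I s Hs Hgen) as [X HX].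
  destruct (Hsc X (X_stable I s Hgen X HX)) as [Xh [HXh [[e He] Hsol]]].
  apply (no_reduction I Pos Rich Q RES s Hs Hgen X HX e Xh HXh); [|exact Hsol].
  intros a u Hlt. specialize (He (Cantor.to_nat (a, u))).
  unfold col_code at 2 in He. rewrite Cantor.cancel_of_to in He.
  apply Nat.ltb_lt in Hlt. rewrite Hlt in He.
  unfold Phi. now destruct (Xh a u).
Qed.
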